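(* Let $\sigma_0\in(0,\tfrac14)$ be fixed and let $\sigma=\sigma(n)\in[0,\sigma_0]$. Let $k=k(n)$, $\mathbf n=\mathbf n(n)\in\mathbb N^k$ and $P=P(n)=(p_{ij})_{i,j\in[k]}$ be such that $p_{ij}=p_{ji}$ and $0\le p_{ij}<1$ for all $i,j\in[k]$. Let $Q=(q_{ij})$ with $q_{ij}=\log\frac{1}{1-p_{ij}}$, and let $q^*$, $\hat q(\cdot)$, $w_*(\cdot,Q)$ be as in the context. Assume that, as $n\to\infty$, $$\|\mathbf n\|\to\infty,\qquad k=\|\mathbf n\|^{o(1)},\qquad q^*=\|\mathbf n\|^{-\sigma+o(1)},\qquad \hat q(\mathbf n)=\|\mathbf n\|^{-\sigma+o(1)},$$ $$\Big(1+\frac1{q^*}\Big)\max_{i,j\in[k]}q_{ij}\ll\log\|\mathbf n\|,\qquad w_*(\mathbf n,Q)\gg k\,\hat q(\mathbf n)\,q^*\frac{\|\mathbf n\|}{\log\|\mathbf n\|}.$$ Then, with high probability, $$\chi(\mathbf G)=(1+o(1))\frac{w_*(\mathbf n,Q)}{2(1-\sigma)\log\|\mathbf n\|},\qquad \mathbf G\sim\mathcal G(\mathbf n,P).$$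
   Context: Stochastic block model $\mathcal G(\mathbf n,P)$: for a positive integer $k$, $\mathbf n=(n_1,\dots,n_k)^T$ and a symmetric $k\times k$ matrix $P=(p_{ij})$ with entries in $[0,1)$, the random graph $\mathbf G$ has vertex set partitioned into blocks $B_1,\dots,B_k$ with $|B_i|=n_i$, and each pair of distinct vertices $u\in B_i$, $v\in B_j$ is an edge independently with probability $p_{ij}$. $\|\mathbf x\|=|x_1|+\dots+|x_k|$ (the 1-norm). For $\mathbf x,\mathbf y\in\mathbb R^k$, $\mathbf y\preceq\mathbf x$ means $\mathbf x-\mathbf y\in[0,\infty)^k$. For $\mathbf x\in[0,\infty)^k$, $w(\mathbf x,Q)=\max_{\mathbf 0\preceq\mathbf y\preceq\mathbf x}\frac{\mathbf y^TQ\mathbf y}{\|\mathbf y\|}$ (the ratio taken to be $0$ at $\mathbf y=\mathbf 0$), and $w_*(\mathbf x,Q)=\inf\sum_{\mathbf y\in\mathcal S}w(\mathbf y,Q)$, the infimum over all finite systems $\mathcal S$ of vectors in $[0,\infty)^k$ with $\sum_{\mathbf y\in\mathcal S}\mathbf y=\mathbf x$. $q^*=\max_{i}q_{ii}$; $\hat q(\mathbf x)=\frac{\sum_i x_iq_{ii}}{\|\mathbf x\|}$ for $\mathbf x\ne\mathbf 0$. All quantities depend on $n\to\infty$; asymptotic notation ($o,\ll,\gg$, ''with high probability'' = with probability tending to $1$) refers to $n\to\infty$ and holds uniformly over all sequences satisfying the hypotheses; $a\ll b$ means $a=o(b)$ for positive sequences; $X=(1+o(1))Y$ whp means for every fixed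 $\epsilon>0$, $(1-\epsilon)Y\le X\le(1+\epsilon)Y$ with probability tending to $1$. $\log$ is the natural logarithm; $\chi$ is the chromatic number. *)

(* Defs.v *)
From HB Require Import structures.
From mathcomp Require Import all_boot all_order all_algebra.
From mathcomp Require Import all_classical all_reals all_analysis.

Set Implicit Arguments.
Unset Strict Implicit.
Unset Printing Implicit Defensive.

Import Order.TTheory GRing.Theory Num.Theory.
Import numFieldNormedType.Exports.

Local Open Scope ring_scope.

Section Graphs.
Variable V : finType.
Implicit Types (G : {set {set V}}) (u v : V).

Definition vpairs : {set {set V}} := [set e : {set V} | #|e| == 2]%SET.

(* A simple graph on V is given by its edge set G \subset vpairs. *)
Definition adj (G : {set {set V}}) (u v : V) : bool := [set u; v]%SET \in G.

Definition colorable (G : {set {set V}}) (c : nat) : bool :=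
  [exists f : {ffun V -> 'I_c}, [forall u, forall v, adj G u v ==> (f u != f v)]].

Definition chromatic_number (G : {set {set V}}) : nat :=
  [arg min_(c < (ord_max : 'I_#|V|.+1) | colorable G c) (c : nat)].

Lemma adj_neq G u v : G \subset vpairs -> adj G u v -> u != v.
Proof.
move=> /fintype.subsetP sG /sG; rewrite inE; apply: contraTneq => ->.
by rewrite finset.setUid cards1.
Qed.

Lemma colorable_card G : G \subset vpairs -> colorable G #|V|.
Proof.
move=> sG; apply/existsP; exists [ffun u => enum_rank u].
apply/forallP => u; apply/forallP => v; apply/implyP => /(adj_neq sG) uv.
by rewrite !ffunE (inj_eq enum_rank_inj).
Qed.

Lemma chromatic_numberP G : G \subset vpairs ->
  colorable G (chromatic_number G) /\
  forall c, colorable G c -> (chromatic_number G <= c)%N.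
Proof.
move=> sG; rewrite /chromatic_number.
case: arg_minnP => [|c Gc cmin]; first exact: colorable_card.
split=> // d Gd; case: (ltnP d #|V|.+1) => [dV|]; first exact: (cmin (Ordinal dV)).
by move=> /ltnW; apply: leq_trans; rewrite -ltnS.
Qed.

End Graphs.

Section BlockModel.
Variables (R : realType) (k : nat).

(* Vertex set of G(n, P): the i-th block is the fibre of tag over i. *)
Definition vertex (n : 'I_k -> nat) : finType := {i : 'I_k & 'I_(n i)}.

(* The order of enumeration of e is immaterial as P is symmetric. *)
Definition edge_prob (n : 'I_k -> nat) (P : 'M[R]_k) (e : {set vertex n}) : R :=
  if enum e is [:: u; v] then P (tag u) (tag v) else 0.

Definition sbm_mass (n : 'I_k -> nat) (P : 'M[R]_k) (G : {set {set vertex n}}) : R :=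
  \prod_(e in vpairs (vertex n))
    (if e \in G then edge_prob P e else 1 - edge_prob P e).

Definition sbm_prob (n : 'I_k -> nat) (P : 'M[R]_k)
    (A : pred {set {set vertex n}}) : R :=
  \sum_(G : {set {set vertex n}} | (G \subset vpairs (vertex n)) && A G) sbm_mass P G.

Lemma edge_probE n (P : 'M[R]_k) (u v : vertex n) :
  (forall i j, P i j = P j i) -> u != v ->
  edge_prob P [set u; v]%SET = P (tag u) (tag v).
Proof.
move=> symP uv; rewrite /edge_prob.
have : perm_eq (enum [set u; v]%SET) [:: u; v].
  apply: uniq_perm; rewrite ?enum_uniq //= ?inE ?uv //.
  by move=> x; rewrite mem_enum !inE.
move=> pe; have := perm_size pe.
case: (enum _) pe => [|a [|b [|]]] //= pe _.
have : a \in [:: u; v] by rewrite -(perm_mem pe) mem_head.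
have : b \in [:: u; v] by rewrite -(perm_mem pe) !inE eqxx orbT.
have : uniq [:: a; b] by rewrite (perm_uniq pe) /= inE uv.
rewrite /= !inE andbT => ab /orP[]/eqP eb /orP[]/eqP ea; subst a b.
- by rewrite eqxx in ab.
- exact: symP.
- by [].
- by rewrite eqxx in ab.
Qed.

(* Mutual independence of the edges, with the prescribed marginals; E = set0
   gives total mass 1. *)
Lemma sbm_indep n (P : 'M[R]_k) (E : {set {set vertex n}}) :
  E \subset vpairs (vertex n) ->
  sbm_prob P (fun G => E \subset G) = \prod_(e in E) edge_prob P e.
Proof.
move=> sE; set D := vpairs _ in sE *.
pose F e := if e \in D then edge_prob P e else 0.
pose H e := if e \in E then 0 else if e \in D then 1 - edge_prob P e else 1.
have -> : \prod_(e in E) edge_prob P e = \prod_e (F e + H e).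
  rewrite big_mkcond; apply: eq_bigr => e _; rewrite /F /H.
  case: ifP => [eE|_]; first by rewrite (fintype.subsetP sE) // addr0.
  by case: ifP => _; rewrite ?add0r // addrCA subrr addr0.
rewrite bigA_distr /sbm_prob big_mkcond; apply: eq_bigr => G _.
case: ifP => [/andP[sG EG]|/negbT].
  rewrite /sbm_mass big_mkcond; apply: eq_bigr => e _; rewrite /F /H -/D.
  case: ifP => eD; case: ifP => eG //.
  - by case: ifP => // /(fintype.subsetP EG); rewrite eG.
  - by rewrite (fintype.subsetP sG) in eD.
  - by case: ifP => // /(fintype.subsetP sE); rewrite eD.
rewrite negb_and => /orP[/subsetPn[e eG eD]|/subsetPn[e eE eG]].
  by rewrite (bigD1 e) //= eG /F (negbTE eD) mul0r.
by rewrite (bigD1 e) //= (negbTE eG) /H eE mul0r.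
Qed.

End BlockModel.

Local Open Scope classical_set_scope.

Section Weights.
Variables (R : realType) (k : nat).
Implicit Types (x y : 'cV[R]_k) (Q : 'M[R]_k).

Definition norm1 x : R := \sum_i `|x i 0|.

Definition nonnegv x : Prop := forall i, 0 <= x i 0.

Definition prec y x : Prop := nonnegv (x - y).

(* At y = 0 the value is 0, since 0 / 0 = 0. *)
Definition qratio Q y : R := (y^T *m Q *m y) 0 0 / norm1 y.

(* A maximum: the box is compact and qratio Q is continuous on it, also at 0. *)
Definition w x Q : R := sup [set qratio Q y | y in [set y | prec 0 y /\ prec y x]].

(* Systems are lists, so that repeated vectors are counted with multiplicity. *)
Definition wstar x Q : R :=
  inf [set \sum_(y <- S) w y Q | S in
    [set S : seq 'cV[R]_k | {in S, forall y, nonnegv y} /\ \sum_(y <- S) y = x]].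

(* The default value 0 of the two maxima is harmless: they are only used for
   entrywise nonnegative Q. *)
Definition qstar Q : R := \big[Num.max/0]_i Q i i.

Definition qmax Q : R := \big[Num.max/0]_i \big[Num.max/0]_j Q i j.

Definition qhat x Q : R := (\sum_i x i 0 * Q i i) / norm1 x.

Definition logmx (P : 'M[R]_k) : 'M[R]_k := \matrix_(i, j) ln (1 / (1 - P i j)).

Definition vec_of (n : 'I_k -> nat) : 'cV[R]_k := \col_i (n i)%:R.

Lemma w_has_sup x Q : nonnegv x ->
  has_sup [set qratio Q y | y in [set y | prec 0 y /\ prec y x]].
Proof.
move=> x0; split.
  by exists (qratio Q 0); exists 0 => //; split=> i; rewrite ?subr0 // mxE.
pose M : R := \sum_i \sum_j `|Q i j|.
have M0 : 0 <= M by do 2!apply: sumr_ge0 => ? _.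
exists (M * norm1 x) => _ [y [y0 yx] <-].
have yi i : 0 <= y i 0 by have := y0 i; rewrite subr0.
have yxi i : y i 0 <= x i 0 by have := yx i; rewrite !mxE subr_ge0.
have ny : 0 <= norm1 y by apply: sumr_ge0.
have yn i : y i 0 <= norm1 y.
  rewrite /norm1 (bigD1 i) //= ger0_norm // lerDl; exact: sumr_ge0.
have nyx : norm1 y <= norm1 x.
  by apply: ler_sum => i _; rewrite !ger0_norm // (le_trans (yi i)).
rewrite /qratio; have [->|nz] := eqVneq (norm1 y) 0.
  by rewrite invr0 mulr0 mulr_ge0 // (le_trans ny).
rewrite ler_pdivrMr ?lt0r ?nz //.
apply: le_trans (_ : M * (norm1 y * norm1 y) <= _); last first.
  by rewrite -mulrA ler_wpM2l // ler_wpM2r.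
move: (norm1 y) ny yn {nyx nz} => c c0 yc.
rewrite mxE /M exchange_big /= mulr_suml; apply: ler_sum => j _.
rewrite !mxE !mulr_suml; apply: ler_sum => i _; rewrite !mxE.
rewrite (mulrC (y i 0)) -mulrA.
apply: le_trans (ler_norm _) _; rewrite normrM ler_wpM2l //.
by rewrite ger0_norm; [exact: ler_pM | exact: mulr_ge0].
Qed.

End Weights.

(* f = N^(s + o(1)) as n -> oo *)
Definition is_powo (R : realType) (N s f : nat -> R) : Prop :=
  exists2 e : nat -> R, e n @[n --> \oo] --> (0 : R) &
    \forall n \near \oo, f n = N n `^ (s n + e n).

(* a << b, i.e. a = o(b) *)
Definition lls (R : realType) (a b : nat -> R) : Prop :=
  (a : nat -> R^o) =o_\oo (b : nat -> R^o).

Lemma llsP (R : realType) (a b : nat -> R) :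
  lls a b <-> forall eps : R, 0 < eps ->
    \forall n \near \oo, `|a n| <= eps * `|b n|.
Proof. by rewrite /lls eqoP. Qed.

(* Main.v *)
(** Write [N] for the number of vertices and [l = ln N].

    Lower bound.  By a first moment computation, with high probability every
    independent set whose block profile is [y] has
    [y^T Q y <= 2 (1 - sigma + o(1)) l |y|]: a violating set must have at least
    [1 + 1/q*] vertices, because [qmax] is much smaller than [q* l], and this
    size pays for the factor [N^sigma] in the number of vertex sets.  On a box
    [y^T Q y - C |y|] is maximal at a vertex, by convexity in each coordinate,
    so [w] is at most [2 (1 - sigma + o(1)) l] on the profile of a colour
    class, and the colour classes form a system in the definition of [w_*].

    Upper bound.  By Caratheodory a nearly optimal system has at most [k]
    vectors.  Scaling each of them so that [w] becomes [2 (1 - sigma - o(1)) l]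
    and rounding up gives integer profiles; the coordinates too small to be
    rounded are coloured block by block, and the hypothesis
    [w_* >> k qhat q* N / l] makes their cost negligible.  By Janson's
    inequality, applied to the transversals of a partition of the available
    vertices into slots, with probability [1 - exp (- N^(1 + c))] a given vertex
    set which is not too small in the blocks concerned contains an independent
    set with a given such profile; the overlaps of size two dominate and this is
    where [sigma < 1/4] enters.  Hence independent sets can be extracted greedily
    until each block has [N^(1 - c)] vertices left, and the rest has small
    degeneracy. *)
Require Import Defs.
From HB Require Import structures.
From mathcomp Require Import all_boot all_order all_algebra.
From mathcomp Require Import reals sequences exp.
From mathcomp Require boolp classical_sets.
From mathcomp Require Import ring lra.

Set Implicit Arguments.
Unset Strict Implicit.
Unset Printing Implicit Defensive.

Import Order.TTheory GRing.Theory Num.Theory.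
Local Open Scope ring_scope.

(** * Product measures and Janson's inequality *)

Lemma ler_sum_uniq (R : numDomainType) (I : finType) (r : seq I) (P : pred I)
    (F : I -> R) : uniq r -> (forall i, P i -> 0 <= F i) ->
  \sum_(i <- r | P i) F i <= \sum_(i | P i) F i.
Proof.
move=> ur F0; rewrite big_mkcond [leRHS]big_mkcond /= big_uniq //=.
rewrite [leRHS](bigID (mem r)) /= lerDl; apply: sumr_ge0 => i _.
by case: ifP => // /F0.
Qed.

Section ProductMeasure.
Variables (R : realType) (T : finType) (p : T -> R).
Hypothesis p01 : forall e, 0 <= p e <= 1.
Implicit Types (F G : {set T}) (f : {set T} -> R) (e : T).

(** The law of a random subset of [T] that contains each [e] independently with probability
    [p e]. *)
Definition pmass G : R := \prod_e (if e \in G then p e else 1 - p e).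
Definition pexp f : R := \sum_(G : {set T}) pmass G * f G.
Definition pprob (A : pred {set T}) : R := pexp (fun G => (A G)%:R).
Definition vac F G : R := [disjoint F & G]%:R.
(** The probability that every element of [F] is absent, as [pexp_vac] confirms. *)
Definition pvac F : R := \prod_(e in F) (1 - p e).

Lemma pmass_ge0 G : 0 <= pmass G.
Proof.
by apply: prodr_ge0 => e _; case: ifP => _; have /andP[? ?] := p01 e; rewrite ?subr_ge0.
Qed.

Lemma ler_pexp f g : (forall G, f G <= g G) -> pexp f <= pexp g.
Proof. by move=> fg; apply: ler_sum => G _; rewrite ler_wpM2l ?pmass_ge0. Qed.

Lemma eq_pexp f g : f =1 g -> pexp f = pexp g.
Proof. by move=> fg; apply: eq_bigr => G _; rewrite fg. Qed.

Lemma pexp_ge0 f : (forall G, 0 <= f G) -> 0 <= pexp f.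
Proof. by move=> f0; apply: sumr_ge0 => G _; rewrite mulr_ge0 ?pmass_ge0. Qed.

Lemma pexpD f g : pexp (fun G => f G + g G) = pexp f + pexp g.
Proof. by rewrite -big_split; apply: eq_bigr => G _; rewrite mulrDr. Qed.

Lemma pexpZ c f : pexp (fun G => c * f G) = c * pexp f.
Proof. by rewrite /pexp mulr_sumr; apply: eq_bigr => G _; rewrite mulrCA. Qed.

Lemma pexpB f g : pexp (fun G => f G - g G) = pexp f - pexp g.
Proof.
rewrite -[in RHS]mulN1r -pexpZ -pexpD; apply: eq_pexp => G.
by rewrite mulN1r.
Qed.

Lemma pexp_sum (I : Type) (r : seq I) (Q : pred I) (f : I -> {set T} -> R) :
  pexp (fun G => \sum_(i <- r | Q i) f i G) = \sum_(i <- r | Q i) pexp (f i).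
Proof.
rewrite /pexp exchange_big /=; apply: eq_bigr => G _.
by rewrite mulr_sumr.
Qed.

(** Independence: expanding the product on the right, a choice of one summand at each [e] is a set
    [G]. *)
Lemma pexp_prod (h : T -> bool -> R) :
  pexp (fun G => \prod_e h e (e \in G)) =
  \prod_e (p e * h e true + (1 - p e) * h e false).
Proof.
rewrite bigA_distr; apply: eq_bigr => G _; rewrite /pmass -big_split /=.
by apply: eq_bigr => e _; case: ifP.
Qed.

Lemma pexp1 : pexp (fun=> 1) = 1.
Proof.
have := pexp_prod (fun _ _ => 1); under eq_pexp do rewrite big1 //.
move=> ->; rewrite big1 // => e _; by rewrite !mulr1 addrC subrK.
Qed.

Lemma pprob_ge0 A : 0 <= pprob A.
Proof. exact: pexp_ge0. Qed.

Lemma ler_pprob (A B : pred {set T}) : (forall G, A G -> B G) -> pprob A <= pprob B.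
Proof.
move=> AB; apply: ler_pexp => G; case AG: (A G) => //.
by rewrite (AB _ AG).
Qed.

Lemma pprobC A : pprob (fun G => ~~ A G) = 1 - pprob A.
Proof.
rewrite -pexp1 /pprob -pexpB; apply: eq_pexp => G.
by case: (A G); rewrite ?subrr ?subr0.
Qed.

Lemma pprob_le1 A : pprob A <= 1.
Proof. by rewrite -subr_ge0 -pprobC pprob_ge0. Qed.

Lemma pprobU (A B : pred {set T}) :
  pprob (fun G => A G || B G) <= pprob A + pprob B.
Proof.
rewrite /pprob -pexpD; apply: ler_pexp => G.
by case: (A G); case: (B G); rewrite /= ?addr0 ?add0r // lerDl.
Qed.

Lemma pprob_exists (I : finType) (Q : pred I) (A : I -> pred {set T}) :
  pprob (fun G => [exists i, Q i && A i G]) <= \sum_(i | Q i) pprob (A i).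
Proof.
rewrite /pprob -pexp_sum; apply: ler_pexp => G.
case: existsP => [[i /andP[Qi AiG]]|_]; last exact: sumr_ge0.
by rewrite (bigD1 i) //= AiG lerDl; apply: sumr_ge0.
Qed.

(** Conditioning on all coordinates other than [e]: each [G] without [e] is paired with [e |: G]. *)
Lemma pexp_split e f :
  pexp f = \sum_(G : {set T} | e \notin G)
    (\prod_(e' | e' != e) (if e' \in G then p e' else 1 - p e')) *
    ((1 - p e) * f G + p e * f (e |: G)).
Proof.
rewrite /pexp (bigID (fun G : {set T} => e \in G)) /= addrC.
under [RHS]eq_bigr do rewrite mulrDr.
rewrite big_split /=; congr (_ + _).
  by apply: eq_bigr => G eG; rewrite /pmass (bigD1 e) //= (negbTE eG) mulrCA mulrA.
rewrite (reindex_onto (fun G => e |: G) (fun G => G :\ e)) /=; last first.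
  by move=> G eG; rewrite setD1K.
apply: eq_big => [G|G].
  rewrite setU11 /=; apply/eqP/idP => [<-|eG]; first by rewrite setD11.
  by rewrite setU1K.
move=> _; rewrite /pmass (bigD1 e) //= setU11 -mulrA mulrCA; congr (_ * _).
apply: eq_bigr => e' ne.
by rewrite in_setU1 (negbTE ne).
Qed.

(** A one-coordinate Harris inequality: with the other coordinates fixed, the value of [f] without
    [e] is at most its average over the two states of [e]. *)
Lemma pexp_absent_le e f : (forall G, e \notin G -> f G <= f (e |: G)) ->
  pexp (fun G => (e \notin G)%:R * f G) <= (1 - p e) * pexp f.
Proof.
move=> finc; have /andP[p0 p1] := p01 e.
rewrite (pexp_split e) (pexp_split e f) mulr_sumr; apply: ler_sum => G eG.
rewrite eG setU11 /= mul0r mulr0 addr0 mul1r [leRHS]mulrCA ler_wpM2l //.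
  apply: prodr_ge0 => e' _; have /andP[? ?] := p01 e'.
  by case: ifP; rewrite ?subr_ge0.
rewrite ler_wpM2l ?subr_ge0 //.
rewrite -{1}[f G]mul1r -{1}(subrK (p e) 1) mulrDl lerD2l.
by rewrite ler_wpM2l // finc.
Qed.

Lemma pexp_absent_eq e f : (forall G, e \notin G -> f G = f (e |: G)) ->
  pexp (fun G => (e \notin G)%:R * f G) = (1 - p e) * pexp f.
Proof.
move=> finv; rewrite (pexp_split e) (pexp_split e f) mulr_sumr.
apply: eq_bigr => G eG.
rewrite eG setU11 /= mul0r mulr0 addr0 mul1r [RHS]mulrCA -finv //.
by rewrite -mulrDl subrK mul1r.
Qed.

Lemma vacE F G : vac F G = \prod_(e <- enum F) (e \notin G)%:R.
Proof.
rewrite big_enum /= /vac; case: (boolP [disjoint F & G]) => [dFG|].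
  by rewrite big1 // => e eF; rewrite (disjointFr dFG).
by case/pred0Pn=> e /andP[/= eF eG]; rewrite (bigD1 e) //= eG mul0r.
Qed.

Let vacs_setU1 (s : seq T) e G : e \notin s ->
  \prod_(e' <- s) (e' \notin e |: G)%:R = \prod_(e' <- s) (e' \notin G)%:R :> R.
Proof.
move=> es; apply: eq_big_seq => e' e's.
by rewrite in_setU1; case: eqP => // ee; rewrite -ee e's in es.
Qed.

(** The Harris inequality for a decreasing event and an increasing function. The elements of [F] are
    treated one by one; the remaining vacancy factors do not depend on the current one, so the
    integrand stays monotone in it. *)
Lemma pexp_vac_le F f : (forall G e, f G <= f (e |: G)) ->
  pexp (fun G => vac F G * f G) <= pvac F * pexp f.
Proof.
move=> finc; under eq_pexp do rewrite vacE.
rewrite /pvac -big_enum /=; elim: (enum F) (enum_uniq F) => [_|e s IHs /= /andP[es us]].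
  by rewrite big_nil mul1r; under eq_pexp do rewrite big_nil mul1r.
under eq_pexp do rewrite big_cons -mulrA.
apply: le_trans (pexp_absent_le _) _ => [G eG|].
  by rewrite vacs_setU1 // ler_wpM2l // prodr_ge0.
rewrite big_cons -mulrA ler_wpM2l ?IHs //.
by have /andP[? ?] := p01 e; rewrite subr_ge0.
Qed.

(** The same induction with equality at each step: [f] ignores the coordinates in [F], hence is
    independent of them. *)
Lemma pexp_vac_eq F f : (forall G e, e \in F -> f (e |: G) = f G) ->
  pexp (fun G => vac F G * f G) = pvac F * pexp f.
Proof.
move=> finc; under eq_pexp do rewrite vacE.
have : {subset enum F <= F} by move=> e; rewrite mem_enum.
rewrite /pvac -big_enum /=; elim: (enum F) (enum_uniq F) => [_|e s IHs /= /andP[es us]].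
  by rewrite big_nil mul1r; under eq_pexp do rewrite big_nil mul1r.
move=> sF; under eq_pexp do rewrite big_cons -mulrA.
rewrite pexp_absent_eq => [|G eG]; last first.
  by rewrite vacs_setU1 // finc // sF // mem_head.
by rewrite big_cons -mulrA IHs // => e' e's; rewrite sF // in_cons e's orbT.
Qed.

Lemma pexp_vac F : pexp (vac F) = pvac F.
Proof.
have := @pexp_vac_eq F (fun=> 1) (fun _ _ _ => erefl).
by rewrite pexp1 mulr1 => <-; apply: eq_pexp => G; rewrite mulr1.
Qed.

Lemma pvac_ge0 F : 0 <= pvac F.
Proof. by apply: prodr_ge0 => e _; have /andP[? ?] := p01 e; rewrite subr_ge0. Qed.

Lemma vac_ge0 F G : 0 <= vac F G. Proof. exact: ler0n. Qed.
Lemma vac_le1 F G : vac F G <= 1. Proof. by rewrite lern1 leq_b1. Qed.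

Lemma vac_setU1 F G e : vac F (e |: G) <= vac F G.
Proof.
rewrite /vac ler_nat; case: (boolP [disjoint F & e |: G]) => // d.
by rewrite (disjointWr (subsetUr [set e] G) d).
Qed.

Lemma vac_setU1_notin F G e : e \notin F -> vac F (e |: G) = vac F G.
Proof.
by move=> eF; rewrite !vacE vacs_setU1 // mem_enum.
Qed.

Lemma vacU F F' G : vac (F :|: F') G = vac F G * vac F' G.
Proof. by rewrite /vac -!setI_eq0 setIUl setU_eq0 -natrM mulnb. Qed.

Section Janson.
Variables (J : finType) (E : J -> {set T}) (s : R).
Hypothesis s01 : 0 <= s <= 1.

Let Z (Q : pred J) (r : seq J) G : R := \prod_(j <- r | Q j) (1 - s * vac (E j) G).

Let fac01 j G : 0 <= 1 - s * vac (E j) G <= 1.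
Proof.
have /andP[s0 s1] := s01; apply/andP; split.
  by rewrite subr_ge0 mulr_ile1 ?vac_ge0 ?vac_le1.
by rewrite lerBlDr lerDl mulr_ge0 ?vac_ge0.
Qed.

Let Z_ge0 Q r G : 0 <= Z Q r G.
Proof. by apply: prodr_ge0 => j _; case/andP: (fac01 j G). Qed.

Let Z_inc Q r G e : Z Q r G <= Z Q r (e |: G).
Proof.
apply: ler_prod => j _; case/andP: (fac01 j G) => -> _ /=.
rewrite lerD2l lerN2 ler_wpM2l ?vac_setU1 //; by case/andP: s01.
Qed.

(** The Weierstrass product inequality. *)
Let Z_lin Q r G : 1 - s * \sum_(j <- r | Q j) vac (E j) G <= Z Q r G.
Proof.
have /andP[s0 s1] := s01.
rewrite /Z; elim: r => [|j r IHr]; first by rewrite !big_nil mulr0 subr0.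
rewrite !big_cons; case: ifP => // _.
set x := \sum_(_ <- _ | _) _ in IHr *; set P := \prod_(_ <- _ | _) _ in IHr *.
have P1 : P <= 1 by apply: Num.Theory.prodr_ile1 => i _.
have P0 : 0 <= P := Z_ge0 Q r G.
have : s * vac (E j) G * P <= s * vac (E j) G by rewrite ler_piMr // mulr_ge0 ?vac_ge0.
lra.
Qed.

(* Discrete form of Janson's exponential-moment argument: [1 - s * vac] plays
   the role of [exp (- s * vac)], and the events are revealed one at a time. *)
Lemma janson_aux :
  pprob (fun G => [forall j, ~~ [disjoint E j & G]]) <=
  expR (- s * (\sum_j pvac (E j)) +
    s ^+ 2 * \sum_i \sum_(j | ~~ [disjoint E j & E i]) pvac (E i :|: E j)).
Proof.
have /andP[s0 s1] := s01.
apply: le_trans (_ : pexp (Z xpredT (enum J)) <= _).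
  apply: ler_pexp => G; case: forallP => [dG|_]; last exact: Z_ge0.
  by rewrite /Z big1 // => j _; rewrite /vac (negbTE (dG j)) mulr0 subr0.
pose D i := \sum_(j | ~~ [disjoint E j & E i]) pvac (E i :|: E j).
have -> : - s * (\sum_j pvac (E j)) + s ^+ 2 * \sum_i D i =
    \sum_(i <- enum J) (s ^+ 2 * D i - s * pvac (E i)).
  by rewrite big_enum /= !mulr_sumr -big_split /=; apply: eq_bigr => i _; ring.
elim: (enum J) (enum_uniq J) => [_|i r IHr /= /andP[ir ur]].
  by rewrite big_nil expR0 /Z; under eq_pexp do rewrite big_nil; rewrite pexp1.
rewrite big_cons expRD.
have ef : pexp (Z xpredT (i :: r)) =
    pexp (Z xpredT r) - s * pexp (fun G => vac (E i) G * Z xpredT r G).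
  rewrite -pexpZ -pexpB; apply: eq_pexp => G.
  by rewrite /Z big_cons mulrBl mul1r mulrA.
rewrite {}ef.
(* If this is negative, the new exponential factor is at least 1, and it suffices to drop the factor
   of [i] from the product. *)
have [neg|pos] := ltP (pvac (E i) - s * D i) 0.
  apply: le_trans (_ : pexp (Z xpredT r) <= _).
    rewrite lerBlDr lerDl mulr_ge0 // pexp_ge0 // => G.
    by rewrite mulr_ge0 ?vac_ge0.
  apply: le_trans (IHr ur) _; rewrite ler_peMl ?expR_ge0 //.
  rewrite -[leLHS]expR0 ler_expR.
  have : s * (pvac (E i) - s * D i) <= 0 by rewrite mulr_ge0_le0 // ltW.
  by rewrite expr2; lra.
(* The earlier sets are split into those meeting [E i] and those disjoint from it. [Y] collects the
   latter and is independent of [vac (E i)]; the others are bounded below by [Z_lin], and the Harris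
   inequality treats each term. *)
pose dep j := ~~ [disjoint E j & E i].
pose Y G := Z (predC dep) r G.
have key : pexp Y * (pvac (E i) - s * D i) <=
    pexp (fun G => vac (E i) G * Z xpredT r G).
  apply: le_trans (_ : pexp (fun G => vac (E i) G * Y G
    - s * \sum_(j <- r | dep j) vac (E i :|: E j) G * Y G) <= _).
    rewrite pexpB pexpZ pexp_sum mulrBr lerB //.
      rewrite pexp_vac_eq 1?mulrC // => G e ei; rewrite /Y.
      apply: eq_bigr => j dj; rewrite vac_setU1_notin //.
      by move: dj; rewrite /dep /= negbK => /disjointFl ->.
    rewrite mulrCA ler_wpM2l // mulr_sumr.
    apply: le_trans (_ : \sum_(j <- r | dep j) pexp Y * pvac (E i :|: E j) <= _).
      apply: ler_sum => j _; rewrite mulrC; apply: pexp_vac_le => G e; exact: Z_inc.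
    apply: ler_sum_uniq => // j _.
    by rewrite mulr_ge0 ?pvac_ge0 // pexp_ge0 // => G; exact: Z_ge0.
  apply: ler_pexp => G.
  have -> : Z xpredT r G = Z dep r G * Y G by rewrite /Y /Z [LHS](bigID dep).
  rewrite mulrA; apply: le_trans
    (_ : vac (E i) G * (1 - s * \sum_(j <- r | dep j) vac (E j) G) * Y G <= _).
    rewrite mulrBr mulr1 mulrBl lerD2l lerN2 mulrCA -mulrA ler_wpM2l //.
    rewrite mulr_sumr mulr_suml; apply: ler_sum => j _.
    by rewrite vacU.
  by rewrite ler_wpM2r ?Z_ge0 // ler_wpM2l ?vac_ge0 ?Z_lin.
have ZY : pexp (Z xpredT r) <= pexp Y.
  apply: ler_pexp => G; rewrite /Y /Z [leLHS](bigID dep) /=.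
  rewrite ler_piMl ?Z_ge0 //; apply: Num.Theory.prodr_ile1 => j _; exact: fac01.
apply: le_trans (_ : pexp (Z xpredT r) * (1 - s * (pvac (E i) - s * D i)) <= _).
  rewrite mulrBr mulr1 lerD2l lerN2 mulrCA ler_wpM2l //.
  by apply: le_trans key; rewrite ler_wpM2r.
have e1 := expR_ge1Dx (s ^+ 2 * D i - s * pvac (E i)).
rewrite mulrC; apply: le_trans (_ : expR (s ^+ 2 * D i - s * pvac (E i)) * pexp (Z xpredT r) <= _).
  rewrite ler_wpM2r ?pexp_ge0 // ?Z_ge0 //.
  by apply: le_trans e1; rewrite le_eqVlt; apply/orP; left; apply/eqP; ring.
by rewrite ler_wpM2l ?expR_ge0 ?IHr.
Qed.

End Janson.

Lemma janson (J : finType) (E : J -> {set T}) (mu D : R) :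
  mu = \sum_j pvac (E j) -> 0 < mu -> 1 <= 2 * mu * D ->
  \sum_i \sum_(j | ~~ [disjoint E j & E i]) pvac (E i :|: E j) <= mu ^+ 2 * D ->
  pprob (fun G => [forall j, ~~ [disjoint E j & G]]) <= expR (- (1 / (4 * D))).
Proof.
move=> muE mu0 muD dD.
have D0 : 0 < D by rewrite -(pmulr_rgt0 _ mu0); lra.
(* This [s] minimises [- s * mu + s ^+ 2 * mu ^+ 2 * D], with minimum [- 1 / (4 * D)]; the
   assumption [1 <= 2 * mu * D] gives [s <= 1]. *)
pose s := 1 / (2 * mu * D).
have s0 : 0 < s by rewrite divr_gt0 // !mulr_gt0.
have s1 : s <= 1 by rewrite ler_pdivrMr ?mul1r // !mulr_gt0.
apply: le_trans (@janson_aux _ E s _) _; first by rewrite ltW.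
rewrite ler_expR -muE.
apply: le_trans (_ : - s * mu + s ^+ 2 * (mu ^+ 2 * D) <= _).
  by rewrite lerD2l ler_wpM2l // exprn_ge0 // ltW.
rewrite le_eqVlt; apply/orP; left; apply/eqP; rewrite /s.
by field; rewrite ?lt0r_neq0.
Qed.

End ProductMeasure.

(** * Exponential sums over subsets *)

Section SubsetSums.
Variables (R : realType) (T : finType).

Lemma sum_set_exp (y : R) : \sum_(X : {set T}) y ^+ #|X| = (1 + y) ^+ #|T|.
Proof.
have -> : (1 + y) ^+ #|T| = \prod_(i : T) (y + 1) by rewrite prodr_const addrC.
rewrite bigA_distr; apply: eq_bigr => X _.
by rewrite -[RHS]big_mkcond prodr_const.
Qed.

Lemma sum_set_le (y : R) : 0 <= y -> \sum_(X : {set T}) y ^+ #|X| <= expR (y * #|T|%:R).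
Proof.
move=> y0; rewrite sum_set_exp mulrC expRM_natl.
by apply: lerXn2r; rewrite ?nnegrE ?addr_ge0 ?expR_ge0 // expR_ge1Dx.
Qed.

(** With [v = ln (N / u0)] and [x + v <= 0], a set of size [m >= u0] contributes at most
    [expR (u0 * (x + v)) * (u0 / N) ^+ m]; summing the powers of [u0 / N] over all sets costs only
    [expR u0]. This replaces binomial estimates in every union bound over vertex sets. *)
Lemma sum_set_tail (x u0 N : R) : 0 < u0 -> 0 < N -> #|T|%:R <= N ->
  x + ln (N / u0) <= 0 ->
  \sum_(X : {set T} | u0 <= #|X|%:R) expR (x * #|X|%:R) <=
  expR (u0 * (1 + x + ln (N / u0))).
Proof.
move=> u00 N0 TN x0.
set v := ln _ in x0 *.
have vE : expR v = N / u0 by rewrite lnK // posrE divr_gt0.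
have -> : u0 * (1 + x + v) = u0 * (x + v) + u0 by ring.
rewrite expRD.
apply: le_trans (_ : \sum_(X : {set T} | u0 <= #|X|%:R)
   expR (u0 * (x + v)) * (u0 / N) ^+ #|X| <= _).
  apply: ler_sum => X uX.
  have -> : u0 / N = expR (- v) by rewrite expRN vE invf_div.
  rewrite -expRM_natr -expRD ler_expR.
  have : (#|X|%:R - u0) * (x + v) <= 0 by rewrite mulr_ge0_le0 // subr_ge0.
  lra.
rewrite -mulr_sumr ler_wpM2l ?expR_ge0 //.
apply: le_trans (_ : \sum_(X : {set T}) (u0 / N) ^+ #|X| <= _).
  rewrite [leRHS](bigID (fun X : {set T} => u0 <= #|X|%:R)) /= lerDl.
  by apply: sumr_ge0 => X _; rewrite exprn_ge0 // divr_ge0 // ltW.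
apply: le_trans (sum_set_le _) _; first by rewrite divr_ge0 // ltW.
by rewrite ler_expR mulrAC ler_pdivrMr // ler_pM2l.
Qed.

End SubsetSums.

(** * Independent sets in the block model *)

Section Pairs.
Variable V : finType.
Implicit Types (G : {set {set V}}) (A B W X : {set V}).

Definition pairsof A : {set {set V}} := [set e : {set V} | (e \subset A) && (#|e| == 2)].

Lemma sum_pairs (M : zmodType) (f : {set V} -> M) A :
  \sum_(u in A) \sum_(v in A | v != u) f [set u; v] =
  (\sum_(e in pairsof A) f e) *+ 2.
Proof.
rewrite pair_big_dep /=.
rewrite (partition_big (fun uv => [set uv.1; uv.2]) (mem (pairsof A))) /=; last first.
  move=> [u v] /and3P[/= uA vA vu]; rewrite inE subUset !sub1set uA vA /=.
  by rewrite cards2 (eq_sym u) vu.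
rewrite -sumrMnl; apply: eq_bigr => e; rewrite inE => /andP[eA /cards2P[a [b [ab eE]]]].
have [aA bA] : a \in A /\ b \in A.
  by move: eA; rewrite eE subUset !sub1set => /andP.
rewrite (eq_bigr (fun=> f e)) => [|uv /andP[_ /eqP->] //].
rewrite sumr_const; congr (_ *+ _).
have -> : 2%N = #|pred2 (a, b) (b, a)| by rewrite card2 xpair_eqE negb_and ab.
apply: eq_card => -[u v]; rewrite -!topredE /= !xpair_eqE.
apply/andP/orP => [[/and3P[uA vA vu] /eqP ee]|].
  have : u \in e by rewrite -ee !inE eqxx.
  have : v \in e by rewrite -ee !inE eqxx orbT.
  rewrite eE !inE => /orP[]/eqP ? /orP[]/eqP ?; subst; rewrite ?eqxx in vu *; by auto.
move=> [/andP[/eqP-> /eqP->]|/andP[/eqP-> /eqP->]]; rewrite aA bA eE /=.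
  by rewrite eqxx (eq_sym b) ab.
by rewrite [[set b; a]]setUC eqxx ab.
Qed.

Lemma pairsofI A B : pairsof A :&: pairsof B = pairsof (A :&: B).
Proof.
by apply/setP => e; rewrite !inE subsetI; case: (#|e| == 2); rewrite ?andbF ?andbT.
Qed.

Lemma pairsof0 A : (#|A| < 2)%N -> pairsof A = set0.
Proof.
move=> A2; apply/setP => e; rewrite !inE; apply/negP => /andP[/subset_leq_card eA /eqP e2].
by rewrite e2 leqNgt A2 in eA.
Qed.

Definition indep G A := [disjoint pairsof A & G].

Lemma indep_adj G A u v : indep G A -> u \in A -> v \in A -> u != v -> ~~ adj G u v.
Proof.
move=> iA uA vA uv; apply: contraTN iA => Guv; apply/pred0Pn.
exists [set u; v]; apply/andP; split=> //=; rewrite inE subUset !sub1set uA vA.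
by rewrite cards2 uv.
Qed.

Lemma indepP G A : (forall u v, u \in A -> v \in A -> ~~ adj G u v) -> indep G A.
Proof.
move=> nA; apply/pred0P => e /=; apply/negP => /andP[].
rewrite inE => /andP[eA /cards2P[a [b [ab eE]]]]; rewrite eE => abG.
move: eA; rewrite eE subUset !sub1set => /andP[aA bA].
by have := nA a b aA bA; rewrite /adj abG.
Qed.

(** Colours are natural numbers rather than ordinals, so that colours can be added without casts. *)
Definition pcol G W (c : nat) : Prop := exists f : V -> nat,
  {in W, forall v, (f v < c)%N} /\
  {in W &, forall u v, u != v -> adj G u v -> f u != f v}.

Lemma pcol_indep G W A c : indep G A -> pcol G (W :\: A) c -> pcol G W c.+1.
Proof.
move=> iA [f [fc fG]]; exists (fun v => if v \in A then c else f v); split.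
  move=> v vW; case: ifP => vA //; rewrite ltnS ltnW // fc //.
  by rewrite inE vA.
move=> u v uW vW uv Guv.
case: ifP => uA; case: ifP => vA.
- by rewrite (negbTE (indep_adj iA uA vA uv)) in Guv.
- by rewrite neq_ltn fc ?orbT // inE vA.
- by rewrite neq_ltn fc // inE uA.
- by apply: fG; rewrite ?inE ?uA ?vA.
Qed.

Definition degin G X v := #|[set u in X | (u != v) && adj G v u]|.

(** Greedy colouring of a degenerate graph: a vertex of degree at most [d] is removed, the rest is
    coloured, and one of the [d.+1] colours is free for it. *)
Lemma pcol_degen G d W :
  (forall X, X \subset W -> X != set0 -> exists2 v, v \in X & (degin G X v <= d)%N) ->
  pcol G W d.+1.
Proof.
move: {2}#|W| (leqnn #|W|) => m; elim: m W => [|m IHm] W Wm degW.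
  move: Wm; rewrite leqn0 cards_eq0 => /eqP->.
  by exists (fun=> 0%N); split=> [v|u v]; rewrite inE.
have [W0|W0] := eqVneq W set0.
  by rewrite W0; exists (fun=> 0%N); split=> [v|u v]; rewrite inE.
have [v vW dv] := degW W (subxx _) W0.
have [||f [fd fG]] := IHm (W :\ v).
- by move: Wm; rewrite (cardsD1 v) vW.
- by move=> X XW; apply: degW; apply: subset_trans XW (subD1set _ _).
pose s := [seq f u | u in [set u in W | (u != v) && adj G v u]].
have ss : (size s <= d)%N by rewrite size_map -cardE.
have [c cd cs] : exists2 c, (c < d.+1)%N & c \notin s.
  have /allPn[c] : ~~ all (mem s) (iota 0 d.+1).
    apply: contraL ss => /allP ss; rewrite -ltnNge -[X in (X <= _)%N](size_iota 0 d.+1).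
    by apply: uniq_leq_size; rewrite ?iota_uniq.
  by rewrite mem_iota /= => cd cs; exists c.
have fs u : u \in W -> u != v -> adj G v u -> f u != c.
  move=> uW uv Gvu; apply: contraNneq cs => <-.
  by apply: map_f; rewrite mem_enum inE uW uv.
exists (fun u => if u == v then c else f u); split.
  by move=> u uW; case: eqVneq => // uv; apply: fd; rewrite !inE uv.
move=> u w uW wW uw Guw; case: (eqVneq u v) => [uv|uv]; case: (eqVneq w v) => [wv|wv].
- by rewrite uv wv eqxx in uw.
- by rewrite eq_sym; apply: fs => //; rewrite -uv.
- by apply: fs => //; rewrite /adj setUC -wv.
- by apply: fG; rewrite // !inE ?uv ?wv.
Qed.

Lemma pcol_colorable G c : G \subset vpairs V -> pcol G setT c -> colorable G c.
Proof.
move=> sG [f [fc fG]]; apply/existsP.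
exists [ffun v => Ordinal (fc v (in_setT v))].
apply/forallP => u; apply/forallP => v; apply/implyP => Guv.
by rewrite !ffunE -val_eqE /= fG // (adj_neq sG).
Qed.

End Pairs.

(** * Block profiles and the probability of independence *)

Section BlockModel.
Variables (R : realType) (k : nat) (P : 'M[R]_k).
Hypothesis symP : forall i j, P i j = P j i.
Hypothesis P01 : forall i j, 0 <= P i j < 1.

Local Notation Q := (logmx P).

Definition quad (x : 'I_k -> R) : R := \sum_i \sum_j x i * x j * Q i j.
Definition qdiag (x : 'I_k -> R) : R := \sum_i x i * Q i i.

Lemma logmx_ge0 i j : 0 <= Q i j.
Proof.
have /andP[p0 p1] := P01 i j; rewrite mxE ln_ge0 // ler_pdivlMr ?subr_gt0 //.
by rewrite mul1r lerBlDr lerDl.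
Qed.

Lemma logmxK i j : 1 - P i j = expR (- Q i j).
Proof.
have /andP[p0 p1] := P01 i j.
by rewrite mxE div1r lnV ?posrE ?subr_gt0 // opprK lnK ?posrE ?subr_gt0.
Qed.

Lemma logmx_ge i j : P i j <= Q i j.
Proof.
have := expR_ge1Dx (- Q i j); rewrite -logmxK; lra.
Qed.

Section Vertices.
Variable n : 'I_k -> nat.
Local Notation V := (vertex n).
Local Notation p := (@edge_prob R k n P).
Implicit Types (A B X : {set V}) (G : {set {set V}}).

Definition prof A (i : 'I_k) : nat := #|[set v in A | tag v == i]|.

Lemma edge_prob_out (e : {set V}) : #|e| != 2 -> p e = 0.
Proof. by rewrite /edge_prob cardE; case: (enum e) => [|u [|v []]]. Qed.

Lemma edge_prob01 e : 0 <= p e < 1.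
Proof.
rewrite /edge_prob; case: (enum e) => [|u [|v []]]; rewrite ?lexx ?ltr01 //.
Qed.

Lemma edge_prob01W e : 0 <= p e <= 1.
Proof. by case/andP: (edge_prob01 e) => -> /ltW. Qed.

(** Sets of vertices that are not pairs have probability 0, so the product measure over all sets of
    vertices agrees with the block model on graphs and, by [pmass_out], vanishes elsewhere. *)
Lemma pmass_vpairs G : G \subset vpairs V -> pmass p G = sbm_mass P G.
Proof.
move=> sG; rewrite /pmass /sbm_mass [RHS]big_mkcond; apply: eq_bigr => e _.
case: (boolP (e \in vpairs V)) => // eD.
have en : #|e| != 2 by move: eD; rewrite inE.
rewrite edge_prob_out // subr0; case: ifP => // /(subsetP sG).
by rewrite (negbTE eD).
Qed.

Lemma pmass_out G : ~~ (G \subset vpairs V) -> pmass p G = 0.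
Proof.
case/subsetPn => e eG; rewrite inE => en.
by rewrite /pmass (bigD1 e) //= eG edge_prob_out // mul0r.
Qed.

Lemma sbm_prob_le1 (A : pred {set {set V}}) : sbm_prob P A <= 1.
Proof.
apply: le_trans (pprob_le1 edge_prob01W A); rewrite /sbm_prob /pprob /pexp.
rewrite [leRHS](bigID (fun G : {set {set V}} => (G \subset vpairs V) && A G)) /=.
rewrite -[leLHS]addr0 lerD //.
  by apply: ler_sum => G /andP[sG ->]; rewrite pmass_vpairs // mulr1.
by apply: sumr_ge0 => G _; rewrite mulr_ge0 // pmass_ge0 //; exact: edge_prob01W.
Qed.

Lemma sbm_prob_ge (A B : pred {set {set V}}) :
  (forall G, G \subset vpairs V -> ~~ B G -> A G) -> 1 - pprob p B <= sbm_prob P A.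
Proof.
move=> BA; rewrite -pprobC.
rewrite /pprob /pexp /sbm_prob [leRHS]big_mkcond; apply: ler_sum => G _.
case: (boolP (G \subset vpairs V)) => sG /=; last by rewrite pmass_out // mul0r.
have := BA G sG; rewrite pmass_vpairs //.
have m0 : 0 <= sbm_mass P G.
  by rewrite -pmass_vpairs // pmass_ge0 //; exact: edge_prob01W.
case: (B G) => /=; first by rewrite mulr0; case: ifP.
by move=> ->; rewrite ?mulr1.
Qed.

Lemma sum_tag (M : zmodType) (F : 'I_k -> M) A :
  \sum_(u in A) F (tag u) = \sum_i F i *+ prof A i.
Proof.
rewrite (partition_big (fun u : V => tag u) xpredT) //=; apply: eq_bigr => i _.
rewrite (eq_bigr (fun=> F i)) => [|u /andP[_ /eqP->] //].
by rewrite sumr_const /prof; congr (_ *+ _); apply: eq_card => u; rewrite inE.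
Qed.

Lemma card_prof A : #|A| = (\sum_i prof A i)%N.
Proof.
rewrite -sum1_card (partition_big (fun u : V => tag u) xpredT) //=.
by apply: eq_bigr => i _; rewrite sum1dep_card.
Qed.

Definition profR A (i : 'I_k) : R := (prof A i)%:R.

Lemma card_profR A : #|A|%:R = \sum_i profR A i.
Proof. by rewrite card_prof natr_sum. Qed.

Lemma sum_tag2 A : \sum_(u in A) \sum_(v in A) Q (tag u) (tag v) = quad (profR A).
Proof.
under eq_bigr do rewrite (sum_tag (fun j => Q _ j)).
rewrite (sum_tag (fun i => \sum_j Q i j *+ prof A j)); apply: eq_bigr => i _.
rewrite -sumrMnl; apply: eq_bigr => j _.
by rewrite /profR -[in LHS]mulr_natr -[in LHS]mulr_natr; ring.
Qed.

(** The sum of [Q] over the unordered pairs inside [A]: [quad] counts ordered pairs and also the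
    diagonal. It is minus the logarithm of the probability that [A] is independent. *)
Definition eloss A : R := (quad (profR A) - qdiag (profR A)) / 2.

Lemma pvac_pairs A : pvac p (pairsof A) = expR (- eloss A).
Proof.
pose qe (e : {set V}) := - ln (1 - p e).
have pe e : 1 - p e = expR (- qe e).
  by rewrite opprK lnK // posrE subr_gt0; case/andP: (edge_prob01 e).
rewrite /pvac (eq_bigr (fun e => expR (- qe e))) // -expR_sum sumrN.
congr (expR (- _)).
suff : (\sum_(e in pairsof A) qe e) *+ 2 = quad (profR A) - qdiag (profR A).
  by rewrite /eloss => <-; rewrite mulr2n; lra.
rewrite -sum_pairs -sum_tag2.
have -> : qdiag (profR A) = \sum_(u in A) Q (tag u) (tag u).
  rewrite (sum_tag (fun i => Q i i)); apply: eq_bigr => i _.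
  by rewrite mulrC mulr_natr.
rewrite -sumrB; apply: eq_bigr => u uA.
rewrite [in RHS](bigD1 u) //= addrAC subrr add0r; apply: eq_bigr => v /andP[vA vu].
rewrite /qe edge_probE ?[_ == v]eq_sym // logmxK expRK opprK //.
Qed.

Lemma eloss_le_quad A : eloss A <= quad (profR A) / 2.
Proof.
rewrite ler_pM2r ?invr_gt0 // lerBlDr lerDl.
by apply: sumr_ge0 => i _; rewrite mulr_ge0 ?logmx_ge0.
Qed.

Lemma prof_le A B i : A \subset B -> (prof A i <= prof B i)%N.
Proof.
move=> AB; apply: subset_leq_card; apply/subsetP => v.
by rewrite !inE => /andP[/(subsetP AB)-> ->].
Qed.

Lemma prof_setD A B i : B \subset A -> prof (A :\: B) i = (prof A i - prof B i)%N.
Proof.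
move=> BA; rewrite /prof.
have -> : [set v in A :\: B | tag v == i] =
   [set v in A | tag v == i] :\: [set v in B | tag v == i].
  apply/setP => v; rewrite !inE; case: (v \in B); case: (tag v == i) => //=.
  by rewrite !andbF.
rewrite cardsD; congr (_ - _)%N; apply: eq_card => v; rewrite !inE.
case: (boolP (v \in B)) => [/(subsetP BA)->|]; rewrite ?andbF ?andbT //=.
by rewrite andbb.
Qed.

Lemma prof_setT i : prof setT i = n i.
Proof.
pose h (a : 'I_(n i)) : V := Tagged (fun j => 'I_(n j)) a.
have hI : injective h by move=> a b /eqP; rewrite eq_Tagged => /eqP.
rewrite -[RHS]card_ord -(card_imset _ hI); apply: eq_card => v.
rewrite !inE; apply/eqP/imsetP => [vi|[a _ ->] //].
by case: v vi => j a /= ji; subst j; exists a.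
Qed.

End Vertices.

Lemma pvacU (T : finType) (p : T -> R) (E F : {set T}) :
  pvac p (E :|: F) * pvac p (E :&: F) = pvac p E * pvac p F.
Proof.
rewrite /pvac (big_setID E) /= [X in _ = _ * X](big_setID E) /= mulrA.
rewrite setUK setDUl setDv set0U [E :&: F]setIC -!mulrA; congr (_ * _).
exact: mulrC.
Qed.

Lemma prof_imset (z n : 'I_k -> nat) (h : vertex z -> vertex n) (X : {set vertex z}) i :
  injective h -> (forall s, tag (h s) = tag s) -> prof (h @: X) i = prof X i.
Proof.
move=> hI ht; rewrite /prof -(card_imset _ hI); apply: eq_card => v.
rewrite inE; apply/andP/imsetP => [[/imsetP[s sX ->]]|[s]].
  by rewrite ht => si; exists s => //; rewrite inE sX.
by rewrite inE => /andP[sX si] ->; rewrite imset_f // ht.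
Qed.

(** The probability of independence depends only on the profile, so it can be computed in the
    abstract pattern [vertex z]. *)
Lemma pvac_imset (z n : 'I_k -> nat) (h : vertex z -> vertex n) (X : {set vertex z}) :
  injective h -> (forall s, tag (h s) = tag s) ->
  pvac (@edge_prob R k n P) (pairsof (h @: X)) = expR (- eloss X).
Proof.
move=> hI ht; rewrite pvac_pairs /eloss.
have eqp i : profR (h @: X) i = profR X i by rewrite /profR prof_imset.
have -> : quad (profR (h @: X)) = quad (profR X).
  by apply: eq_bigr => i _; apply: eq_bigr => j _; rewrite !eqp.
have -> // : qdiag (profR (h @: X)) = qdiag (profR X).
by apply: eq_bigr => i _; rewrite eqp.
Qed.

(** There is one choice at each point of [X] and there are [g] choices elsewhere. Inverse powers
    avoid subtracting exponents. *)
Lemma card_ffun_agree (S : finType) (g : nat) (f : {ffun S -> 'I_g}) (X : {set S}) :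
  (0 < g)%N ->
  \sum_(f' : {ffun S -> 'I_g} | X \subset [set s | f s == f' s]) 1 =
  g%:R ^+ #|S| * g%:R^-1 ^+ #|X| :> R.
Proof.
move=> g0; have gn : g%:R != 0 :> R by rewrite pnatr_eq0 -lt0n.
pose F s (a : 'I_g) : R := if s \in X then (f s == a)%:R else 1.
transitivity (\sum_(f' : {ffun S -> 'I_g}) \prod_s F s (f' s)).
  rewrite big_mkcond; apply: eq_bigr => f' _; case: ifP => [sX|/negbT/subsetPn[s sX]].
    rewrite big1 // => s _; rewrite /F; case: ifP => // /(subsetP sX).
    by rewrite inE => ->.
  by rewrite inE => /negbTE fs; rewrite (bigD1 s) //= /F sX fs mul0r.
rewrite -bigA_distr_bigA.
transitivity (\prod_(s : S) (g%:R * (if s \in X then g%:R^-1 else 1 : R))).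
  apply: eq_bigr => s _; rewrite /F; case: ifP => _.
    by rewrite mulfV // (bigD1 (f s)) //= eqxx big1 ?addr0 // => a /negbTE; rewrite eq_sym => ->.
  by rewrite mulr1 sumr_const card_ord.
by rewrite big_split /= prodr_const -big_mkcond prodr_const.
Qed.

(** * Janson's inequality for transversals *)

Section Transversals.
Variables (z n : 'I_k -> nat) (g : nat) (v : vertex z -> 'I_g -> vertex n).
Hypothesis g0 : (0 < g)%N.
Hypothesis vI : forall s t a b, v s a = v t b -> s = t /\ a = b.
Hypothesis vt : forall s a, tag (v s a) = tag s.

Local Notation p := (@edge_prob R k n P).

(** For each [s], the map [v s] enumerates a slot of [g] vertices in the block of [s]. The slots are
    disjoint, so every choice function gives a set of profile [z]. *)
Definition trans (f : {ffun vertex z -> 'I_g}) : {set vertex n} :=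
  [set v s (f s) | s in setT].

Let hI (f : {ffun vertex z -> 'I_g}) : injective (fun s => v s (f s)).
Proof. by move=> s t /vI[]. Qed.

Lemma transI f f' :
  trans f :&: trans f' = [set v s (f s) | s in [set s | f s == f' s]].
Proof.
apply/setP => x; rewrite inE; apply/andP/imsetP => [[]|[s]].
  move=> /imsetP[s _ ->] /imsetP[t _ /vI[st ff]]; exists s => //.
  by rewrite inE ff st.
by rewrite inE => /eqP fs ->; rewrite /trans {2}fs !imset_f.
Qed.

(** Janson's inequality for the events that [trans f] is independent. All have the same probability
    [pi]; if [f] and [f'] agree exactly on [X], both occur with probability
    [pi ^+ 2 * expR (eloss X)], and dependence requires agreement in at least two slots. *)
Lemma no_indep_transversal (D : R) :
  \sum_(X : {set vertex z} | (1 < #|X|)%N) expR (eloss X) * g%:R^-1 ^+ #|X| <= D ->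
  0 < D ->
  pprob p (fun G => [forall f, ~~ indep G (trans f)]) <= expR (- (1 / (4 * D))).
Proof.
move=> leD D0.
have gn : g%:R != 0 :> R by rewrite pnatr_eq0 -lt0n.
(* With fewer than two slots a transversal spans no pair and is always independent, so the event is
   empty. *)
have [z1|z1] := ltnP #|vertex z| 2.
  apply: le_trans (_ : 0 <= _); last exact: expR_ge0.
  rewrite -(mul0r (pexp p (fun=> 1))) -pexpZ; apply: ler_pexp => [e|G].
    exact: edge_prob01W.
  rewrite mul0r; case: forallP => // /(_ [ffun=> Ordinal g0]).
  rewrite /indep pairsof0 -?setI_eq0 ?set0I ?eqxx //.
  by rewrite /trans card_imset ?cardsT //; exact: hI.
pose E f := pairsof (trans f).
have pE f : pvac p (E f) = expR (- eloss [set: vertex z]).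
  by rewrite /E pvac_imset.
set pi := expR (- eloss setT) in pE.
have pi0 : 0 < pi by exact: expR_gt0.
have pEE f f' : pvac p (E f :|: E f') = pi ^+ 2 * expR (eloss [set s | f s == f' s]).
  have := pvacU p (E f) (E f'); rewrite !pE pairsofI transI pvac_imset //.
  move/(congr1 ( *%R^~ (expR (eloss [set s | f s == f' s])))).
  by rewrite -mulrA -expRD addNr expR0 mulr1.
set m := #|vertex z| in z1 *.
have muE : g%:R ^+ m * pi = \sum_f pvac p (E f).
  by under eq_bigr do rewrite pE; rewrite sumr_const card_ffun card_ord -natrX mulr_natl.
apply: (janson (edge_prob01W (n := n)) muE).
- by rewrite mulr_gt0 // exprn_gt0 // ltr0n.
(* The term [X = setT] of the sum is the inverse of the expected number of independent transversals,
   so [mu * D] is at least 1. *)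
- have : (g%:R ^+ m * pi) * (expR (eloss [set: vertex z]) * g%:R^-1 ^+ m) = 1.
    transitivity ((g%:R / g%:R) ^+ m * (pi * expR (eloss [set: vertex z]))).
      by rewrite exprMn; ring.
    by rewrite divff // expr1n mul1r /pi -expRD addNr expR0.
  have : expR (eloss [set: vertex z]) * g%:R^-1 ^+ m <= D.
    apply: le_trans leD; rewrite (bigD1 setT) ?cardsT //= lerDl.
    by apply: sumr_ge0 => X _; rewrite mulr_ge0 ?expR_ge0 // exprn_ge0 // invr_ge0.
  have : 0 < g%:R ^+ m * pi by rewrite mulr_gt0 // exprn_gt0 // ltr0n.
  nra.
- apply: le_trans (_ : \sum_(f : {ffun vertex z -> 'I_g})
      pi ^+ 2 * (g%:R ^+ m * D) <= _); last first.
    rewrite sumr_const card_ffun card_ord -natrX -mulr_natl -/m.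
    by rewrite le_eqVlt; apply/orP; left; apply/eqP; ring.
  apply: ler_sum => f _.
  under eq_bigr do rewrite pEE.
  rewrite -mulr_sumr ler_wpM2l ?exprn_ge0 ?(ltW pi0) //.
  (* The agreement set is replaced by all its subsets with at least two elements, so that after
     exchanging the sums only the functions agreeing on a fixed [X] have to be counted. *)
  apply: le_trans (_ : \sum_(f' : {ffun vertex z -> 'I_g})
     \sum_(X : {set vertex z} | (1 < #|X|)%N && (X \subset [set s | f s == f' s]))
        expR (eloss X) <= _).
    rewrite big_mkcond /=; apply: ler_sum => f' _; case: ifP => [|_]; last first.
      by apply: sumr_ge0 => *; exact: expR_ge0.
    rewrite -setI_eq0 pairsofI setIC transI => /set0Pn[e].
    rewrite inE => /andP[/subset_leq_card le /eqP e2].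
    rewrite (bigD1 [set s | f s == f' s]) /=.
      by rewrite lerDl; apply: sumr_ge0 => *; exact: expR_ge0.
    by rewrite subxx andbT; rewrite e2 card_imset // in le; exact: hI.
  rewrite (exchange_big_dep (fun X : {set vertex z} => (1 < #|X|)%N)) /=; last first.
    by move=> f' X _ /andP[].
  apply: le_trans (_ : g%:R ^+ m * \sum_(X : {set vertex z} | (1 < #|X|)%N)
     expR (eloss X) * g%:R^-1 ^+ #|X| <= _); last by rewrite ler_wpM2l ?exprn_ge0.
  rewrite mulr_sumr; apply: ler_sum => X X1.
  rewrite mulrCA -(card_ffun_agree f X g0) mulr_sumr.
  rewrite le_eqVlt; apply/orP; left; apply/eqP; apply: eq_big => [f'|f' _].
    by rewrite X1.
  by rewrite mulr1.
Qed.

End Transversals.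
End BlockModel.

(** * Extraction of independent sets and first moment bounds *)

Section IndependentSets.
Variables (R : realType) (k : nat) (P : 'M[R]_k).
Hypothesis symP : forall i j, P i j = P j i.
Hypothesis P01 : forall i j, 0 <= P i j < 1.
Variable n : 'I_k -> nat.
Local Notation V := (vertex n).
Local Notation Q := (logmx P).
Local Notation p := (@edge_prob R k n P).
Implicit Types (A B W X : {set V}) (G : {set {set V}}).

(** The vertices of [W] in block [i] are enumerated and cut into [z i] consecutive runs of length
    [g]; quotient and remainder by [g] recover the run and the position. *)
Lemma slots_exist (z : 'I_k -> nat) (g : nat) W :
  (forall i, (z i * g <= prof W i)%N) ->
  exists v : vertex z -> 'I_g -> V,
    [/\ forall s t a b, v s a = v t b -> s = t /\ a = b,
        forall s a, tag (v s a) = tag s & forall s a, v s a \in W].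
Proof.
move=> zW.
pose e i := enum [set x in W | tag x == i].
have se i : size (e i) = prof W i by rewrite -cardE.
pose ix (s : vertex z) (a : 'I_g) := (tagged s * g + a)%N.
have ixP s a : (ix s a < size (e (tag s)))%N.
  rewrite se (leq_trans _ (zW _)) // /ix.
  apply: leq_trans (_ : (tagged s).+1 * g <= _)%N; last by rewrite leq_mul2r ltn_ord orbT.
  by rewrite mulSn addnC ltn_add2r.
(* [nth] needs a default vertex; if there is none, there is no index to serve either. *)
case: (pickP (fun _ : V => true)) => [x0 _|none]; last first.
  have F (s : vertex z) (a : 'I_g) : False.
    have := ixP s a; case: (e _) => [//|x ? _]; by have := none x.
  by exists (fun s a => False_rect _ (F s a)); split=> s *; case: (F s _).
pose v s a := nth x0 (e (tag s)) (ix s a).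
have vm s a : v s a \in e (tag s) by rewrite mem_nth.
have vt s a : tag (v s a) = tag s.
  by have := vm s a; rewrite mem_enum inE => /andP[_ /eqP].
exists v; split=> //; last by move=> s a; have := vm s a; rewrite mem_enum inE => /andP[].
move=> s t a b st.
have est : tag s = tag t by rewrite -(vt s a) st vt.
case: s t est st => [i c] [j d] /= ij; subst j => /eqP.
have := ixP (existT _ i c) a; have := ixP (existT _ i d) b.
rewrite /v /ix /= => db ca; rewrite nth_uniq ?enum_uniq // => /eqP E.
have g0 : (0 < g)%N by case: (g) a {ca E vm vt ixP v ix} => [[]|].
have cd : c = d.
  apply/val_inj; rewrite -[LHS](addn0) -[RHS]addn0 -{1}(divn_small (ltn_ord a)).
  by rewrite -(divn_small (ltn_ord b)) -!divnMDl // E.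
split; first by rewrite cd.
by move: E; rewrite cd => /addnI /val_inj.
Qed.

Definition extractable G (z : 'I_k -> nat) W : bool :=
  [exists A : {set V}, [&& A \subset W, [forall i, prof A i == z i] & indep G A]].

Lemma not_extractable (z : 'I_k -> nat) (g : nat) W (D : R) : (0 < g)%N ->
  (forall i, (z i * g <= prof W i)%N) ->
  \sum_(X : {set vertex z} | (1 < #|X|)%N) expR (eloss P X) * g%:R^-1 ^+ #|X| <= D ->
  0 < D ->
  pprob p (fun G => ~~ extractable G z W) <= expR (- (1 / (4 * D))).
Proof.
move=> g0 zW leD D0; have [v [vI vt vW]] := slots_exist zW.
apply: le_trans (no_indep_transversal symP P01 g0 vI vt leD D0).
apply: ler_pprob => [e|G]; first exact: edge_prob01W.
apply: contraNT; rewrite negb_forall => /existsP[f]; rewrite negbK => iF.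
apply/existsP; exists (trans v f); apply/and3P; split=> //.
  by apply/subsetP => _ /imsetP[s _ ->].
apply/forallP => i; rewrite prof_imset ?prof_setT //.
by move=> s t /vI[].
Qed.

(** An integer form of the bound [2 * lam] on the weight of [z]. It makes every subset [X] of the
    pattern independent with probability at least [expR (- lam * #|X|)]. *)
Definition good (lam : R) (z : 'I_k -> nat) : Prop :=
  forall l : 'I_k -> nat, (forall i, (l i <= z i)%N) ->
    quad P (fun i => (l i)%:R) <= 2 * lam * \sum_i (l i)%:R.

Lemma quad_le_max (qm : R) (x : 'I_k -> R) : (forall i j, Q i j <= qm) ->
  (forall i, 0 <= x i) -> quad P x <= qm * (\sum_i x i) ^+ 2.
Proof.
move=> Qm x0; rewrite expr2 mulr_suml mulr_sumr; apply: ler_sum => i _.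
rewrite !mulr_sumr; apply: ler_sum => j _; rewrite mulrC ler_wpM2r ?mulr_ge0 //.
Qed.

(* The terms with [qm * #|X| <= 2 * a] give the first summand of the bound, the
   others have [#|X| >= L0] and give the second. *)
Lemma transversal_sum_le (z : 'I_k -> nat) (g : nat) (lam qm a L0 M : R) :
  (0 < g)%N -> good lam z -> (forall i j, Q i j <= qm) -> 0 <= qm ->
  0 < M -> (\sum_i z i)%:R <= M -> 0 < L0 -> qm * L0 <= 2 * a ->
  M * expR a / g%:R <= 1 ->
  lam - ln g%:R + ln (M / L0) <= 0 ->
  \sum_(X : {set vertex z} | (1 < #|X|)%N) expR (eloss P X) * g%:R^-1 ^+ #|X| <=
  (M * expR a / g%:R) ^+ 2 * expR 1 + expR (L0 * (1 + (lam - ln g%:R) + ln (M / L0))).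
Proof.
move=> g0 gz Qm qm0 M0 zM L00 qL rho1 tail.
have gp : 0 < g%:R :> R by rewrite ltr0n.
set rho := M * _ / _ in rho1 *.
have rho0 : 0 <= rho by rewrite divr_ge0 ?mulr_ge0 ?expR_ge0 ?ltW.
have cV : #|vertex z|%:R <= M.
  apply: le_trans zM; rewrite -cardsT card_prof ler_nat; apply: eq_leq.
  by apply: eq_bigr => i _; rewrite prof_setT.
have eX (X : {set vertex z}) : eloss P X <= lam * #|X|%:R.
  apply: le_trans (eloss_le_quad P01 X) _.
  have := gz (prof X); rewrite (card_profR R) /profR => /(_ _).
  have pz i : (prof X i <= z i)%N by rewrite -[X in (_ <= X)%N]prof_setT prof_le ?subsetT.
  by move=> /(_ pz); lra.
have eX2 (X : {set vertex z}) : eloss P X <= qm * #|X|%:R / 2 * #|X|%:R.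
  apply: le_trans (eloss_le_quad P01 X) _.
  have := quad_le_max (x := profR R X) Qm (fun i => ler0n _ _).
  by rewrite -card_profR expr2; lra.
rewrite (bigID (fun X : {set vertex z} => qm * #|X|%:R <= 2 * a)) /=; apply: lerD.
  (* Each small term is at most [rho ^+ #|X| * M^-1 ^+ #|X|]. As [rho <= 1], its power is at most
     the square, and the powers of [M^-1] sum to at most [expR 1]. *)
  apply: le_trans (_ : \sum_(X : {set vertex z}) rho ^+ 2 * M^-1 ^+ #|X| <= _); last first.
    rewrite -mulr_sumr ler_wpM2l ?exprn_ge0 //.
    apply: le_trans (sum_set_le _ _) _; first by rewrite invr_ge0 ltW.
    by rewrite ler_expR ler_pdivrMl // mulr1.
  rewrite [leRHS](bigID (fun X : {set vertex z} => (1 < #|X|)%N && (qm * #|X|%:R <= 2 * a))) /=.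
  rewrite -[leLHS]addr0 lerD //; last first.
    by apply: sumr_ge0 => X _; rewrite mulr_ge0 ?exprn_ge0 // invr_ge0 ltW.
  apply: ler_sum => X /andP[X1 qX].
  apply: le_trans (_ : rho ^+ #|X| * M^-1 ^+ #|X| <= _).
    rewrite -exprMn /rho mulrAC (mulrC M) mulfK ?lt0r_neq0 // exprMn.
    rewrite ler_wpM2r ?exprn_ge0 ?invr_ge0 // -expRM_natr ler_expR.
    apply: le_trans (eX2 X) _; rewrite ler_wpM2r //; lra.
  rewrite ler_wpM2r ?exprn_ge0 ?invr_ge0 ?(ltW M0) //.
  by apply: ler_wiXn2l.
apply: le_trans (sum_set_tail L00 M0 cV tail).
rewrite big_mkcond [leRHS]big_mkcond /=; apply: ler_sum => X _.
case: ifP => [/andP[X1]|_]; last by case: ifP => // _; exact: expR_ge0.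
rewrite -ltNge => qX; rewrite ifT; last first.
  rewrite leNgt; apply/negP => XL.
  have : qm * #|X|%:R <= qm * L0 by rewrite ler_wpM2l // ltW.
  lra.
rewrite mulrBl expRB [X in _ <= _ / X]expRM_natr lnK ?posrE // -exprVn.
by rewrite ler_wpM2r ?exprn_ge0 ?invr_ge0 // ler_expR.
Qed.

(* Blocks in which [W] has fewer than [theta] vertices are given up: what is left
   in them is coloured at the very end. *)
Definition cut (theta : nat) W (z : 'I_k -> nat) (i : 'I_k) : nat :=
  if (theta <= prof W i)%N then z i else 0%N.

(** The union bound runs over all vertex sets [W], because the set that remains during the greedy
    extraction depends on the graph. A block that is not cut has at least [M * g] vertices, enough
    for [z i] slots of size [g]. *)
Lemma union_extract (zl : seq {ffun 'I_k -> nat}) (g M : nat) (D : R) :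
  (0 < g)%N -> 0 < D ->
  (forall z, z \in zl -> forall W,
    \sum_(X : {set vertex (cut (M * g) W z)} | (1 < #|X|)%N)
      expR (eloss P X) * g%:R^-1 ^+ #|X| <= D) ->
  (forall z, z \in zl -> forall i, (z i <= M)%N) ->
  pprob p (fun G => has (fun z : {ffun 'I_k -> nat} =>
      [exists W, ~~ extractable G (cut (M * g) W z) W]) zl) <=
  (size zl)%:R * (2 ^+ #|V| * expR (- (1 / (4 * D)))).
Proof.
move=> g0 D0; elim: zl => [|z zl IH] DW zM.
  rewrite mul0r -(mul0r (pexp p (fun=> 1))) -pexpZ; apply: ler_pexp => [e|G].
    exact: edge_prob01W.
  by rewrite mul0r.
rewrite [size _]/= -natr1 mulrDl [X in _ + X]mul1r [leRHS]addrC.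
pose F G (y : {ffun 'I_k -> nat}) := [exists W, ~~ extractable G (cut (M * g) W y) W].
apply: le_trans (pprobU _ (fun G => F G z) (fun G => has (F G) zl)) _.
  exact: edge_prob01W.
apply: lerD; last first.
  by apply: IH => x xz; [apply: DW|apply: zM]; rewrite in_cons xz orbT.
apply: le_trans (_ : \sum_(W : {set V}) expR (- (1 / (4 * D))) <= _); last first.
  rewrite sumr_const -[leLHS]mulr_natl le_eqVlt; apply/orP; left; apply/eqP; congr (_ * _).
  by rewrite -[in LHS]cardsT -powersetT card_powerset cardsT natrX.
apply: le_trans (ler_pprob (B := fun G =>
    [exists W, true && ~~ extractable G (cut (M * g) W z) W]) _ _) _ => //.
  exact: edge_prob01W.
apply: le_trans (pprob_exists _ _ _) _; first exact: edge_prob01W.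
apply: ler_sum => W _; apply: (not_extractable (g := g)) D0 => //; last first.
  by apply: DW; rewrite mem_head.
move=> i; rewrite /cut; case: ifP => [|_]; last by rewrite mul0n.
by apply: leq_trans; rewrite leq_mul2r zM ?mem_head ?orbT.
Qed.

(** Invariant: each block has at most [theta] vertices more than the remaining profiles can remove.
    A step removes the full [z i] from a block with at least [theta] vertices and leaves a smaller
    block alone, for which the invariant is trivial. *)
Lemma greedy_coloring G (theta c0 : nat) (zs : seq {ffun 'I_k -> nat}) W :
  (forall z, z \in zs -> forall W', extractable G (cut theta W' z) W') ->
  (forall W', (forall i, prof W' i <= theta)%N -> pcol G W' c0) ->
  (forall i, prof W i <= \sum_(z <- zs) z i + theta)%N ->
  pcol G W (size zs + c0).
Proof.
elim: zs W => [|z zs IH] W ext base Wz.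
  by apply: base => i; have := Wz i; rewrite big_nil.
have /existsP[A /and3P[AW /forallP pA iA]] := ext z (mem_head _ _) W.
rewrite /= addSn; apply: pcol_indep iA _; apply: IH => //.
  by move=> x xz; apply: ext; rewrite in_cons xz orbT.
move=> i; rewrite prof_setD // (eqP (pA i)) /cut; case: (leqP theta (prof W i)) => tW.
  by have := Wz i; rewrite big_cons leq_subLR addnA.
by rewrite subn0 (leq_trans (ltnW tW)) // leq_addl.
Qed.

(** First moment. A violating set has at least [u0] vertices, since [quad] is at most
    [qm * #|A| ^+ 2]; its probability of being independent is at most
    [expR ((qm / 2 - lam) * #|A|)], where [qm / 2] accounts for the diagonal. *)
Lemma sparse_indep (lam qm u0 N : R) : (forall i j, Q i j <= qm) -> 0 <= qm ->
  0 < u0 -> 0 < N -> #|V|%:R <= N -> 0 <= lam -> qm * u0 <= 2 * lam ->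
  qm / 2 - lam + ln (N / u0) <= 0 ->
  pprob p (fun G => [exists A : {set V}, (2 * lam * #|A|%:R < quad P (profR R A)) && indep G A])
    <= expR (u0 * (1 + (qm / 2 - lam) + ln (N / u0))).
Proof.
move=> Qm qm0 u00 N0 VN lam0 qu tail.
apply: le_trans (pprob_exists _ _ _) _; first exact: edge_prob01W.
apply: le_trans (sum_set_tail u00 N0 VN tail).
rewrite big_mkcond [leRHS]big_mkcond /=; apply: ler_sum => A _.
case: ifP => [bA|_]; last by case: ifP => // _; exact: expR_ge0.
rewrite ifT; last first.
  rewrite leNgt; apply/negP => Au.
  have := quad_le_max (x := profR R A) Qm (fun i => ler0n _ _).
  rewrite -card_profR expr2 => qA.
  have : qm * #|A|%:R <= qm * u0 by rewrite ler_wpM2l // ltW.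
  have := ler0n R #|A|; nra.
have -> : pprob p (fun G => indep G A) = pvac p (pairsof A) by rewrite -pexp_vac.
rewrite pvac_pairs // ler_expR /eloss.
have dq : qdiag P (profR R A) <= qm * #|A|%:R.
  rewrite card_profR mulr_sumr; apply: ler_sum => i _.
  by rewrite mulrC ler_wpM2r // ler0n.
lra.
Qed.

Lemma sum_degin G X :
  \sum_(v in X) (degin G X v)%:R = (#|pairsof X :&: G|%:R *+ 2 : R).
Proof.
have -> : #|pairsof X :&: G|%:R = \sum_(e in pairsof X) (e \in G)%:R :> R.
  rewrite -natr_sum -sum1_card; congr (_%:R).
  rewrite big_mkcond [RHS]big_mkcond /=; apply: eq_bigr => e _.
  by rewrite inE; case: (e \in pairsof X); case: (e \in G).
rewrite -sum_pairs; apply: eq_bigr => v vX.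
rewrite -natr_sum /degin -sum1_card; congr (_%:R).
rewrite big_mkcond [RHS]big_mkcond /=; apply: eq_bigr => u _.
rewrite inE -/(adj G v u).
by case: (u \in X); case: (u != v); case: (adj G v u).
Qed.

(** Exponential moment of the number of edges in [F]: an edge of probability [p] contributes
    [1 + p * (expR 1 - 1)], at most [expR (expR 1 * p)]. *)
Lemma pexp_expcard (F : {set {set V}}) :
  pexp p (fun G => expR (#|F :&: G|%:R)) <= expR (expR 1 * \sum_(e in F) p e).
Proof.
pose h (e : {set V}) (b : bool) : R := if (e \in F) && b then expR 1 else 1.
have -> : pexp p (fun G => expR (#|F :&: G|%:R)) = pexp p (fun G => \prod_e h e (e \in G)).
  apply: eq_pexp => G; rewrite /h -big_mkcond /= -[X in expR X]mulr1 expRM_natl.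
  by rewrite -prodr_const; apply: eq_bigl => e; rewrite inE.
rewrite pexp_prod /h mulr_sumr expR_sum [leRHS]big_mkcond /=; apply: ler_prod => e _.
have /andP[p0 p1] := edge_prob01W P01 e.
rewrite andbF mulr1; case: (e \in F) => /=.
  have e1 : 1 <= expR 1 :> R by rewrite -[leLHS]expR0 ler_expR.
  apply/andP; split; first by rewrite addr_ge0 ?mulr_ge0 ?subr_ge0 ?expR_ge0.
  by apply: le_trans (expR_ge1Dx _); lra.
by rewrite mulr1 addrC subrK ler01 lexx.
Qed.

(** If all degrees in [X] exceed [d], then [X] spans at least [d * #|X| / 2] edges. Markov's
    inequality for the exponential of the edge count bounds this event, and the union over nonempty
    [X] is [sum_set_tail] with [u0 = 1]. *)
Lemma sparse_degen (qm N : R) (d r : nat) : (forall i j, Q i j <= qm) -> 0 <= qm ->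
  0 < N -> #|V|%:R <= N ->
  (expR 1 * (qm * r%:R) - d%:R) / 2 + ln N <= 0 ->
  pprob p (fun G => [exists X : {set V}, [&& X != set0, (#|X| <= r)%N &
     [forall v in X, (d < degin G X v)%N]]])
    <= expR (1 + (expR 1 * (qm * r%:R) - d%:R) / 2 + ln N).
Proof.
move=> Qm qm0 N0 VN tail; set x := _ / 2 in tail *.
apply: le_trans (ler_pprob (B := fun G => [exists X : {set V},
  ((X != set0) && (#|X| <= r)%N) && [forall v in X, (d < degin G X v)%N]]) _ _) _.
- exact: edge_prob01W.
- by move=> G /existsP[X XG]; apply/existsP; exists X; rewrite -andbA.
apply: le_trans (pprob_exists _ _ _) _; first exact: edge_prob01W.
have := sum_set_tail (T := V) (x := x) (ltr01 : 0 < 1 :> R) N0 VN.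
rewrite divr1 mul1r => /(_ tail); apply: le_trans.
rewrite big_mkcond [leRHS]big_mkcond /=; apply: ler_sum => X _.
case: ifP => [/andP[X0 Xr]|_]; last by case: ifP => // _; exact: expR_ge0.
rewrite ifT; last by rewrite ler1n card_gt0.
set F := pairsof X.
apply: le_trans (_ : pexp p (fun G => expR (- (d%:R / 2 * #|X|%:R)) * expR (#|F :&: G|%:R)) <= _).
  apply: ler_pexp => [e|G]; first exact: edge_prob01W.
  case: (boolP [forall v in X, _]) => [/forall_inP dX|_]; last by rewrite mulr_ge0 ?expR_ge0.
  rewrite -expRD -[leLHS]expR0 ler_expR.
  have := sum_degin G X; have : \sum_(v in X) d%:R <= \sum_(v in X) (degin G X v)%:R :> R.
    by apply: ler_sum => v vX; rewrite ler_nat ltnW // dX.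
  rewrite sumr_const -[X in X <= _]mulr_natr mulr2n; lra.
rewrite pexpZ; apply: le_trans (_ : expR (- (d%:R / 2 * #|X|%:R)) *
    expR (expR 1 * \sum_(e in F) p e) <= _).
  by rewrite ler_wpM2l ?expR_ge0 ?pexp_expcard.
rewrite -expRD ler_expR.
have : \sum_(e in F) p e *+ 2 <= qm * #|X|%:R * r%:R.
  rewrite sumrMnl -sum_pairs; apply: le_trans (_ : \sum_(u in X) \sum_(v in X) qm <= _).
    apply: ler_sum => u uX; rewrite big_mkcondr /=; apply: ler_sum => v vX.
    case: ifP => // vu; rewrite edge_probE // 1?eq_sym //.
    by apply: le_trans (Qm _ _); apply: logmx_ge.
  have -> : \sum_(u in X) \sum_(v in X) qm = qm * #|X|%:R * #|X|%:R.
    by rewrite !sumr_const -mulrnA -[LHS]mulr_natr natrM mulrA.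
  by rewrite ler_wpM2l ?mulr_ge0 ?ler0n // ler_nat.
rewrite sumrMnl mulr2n => Fq.
have e0 : 0 <= expR 1 :> R by exact: expR_ge0.
have := ler_wpM2l e0 Fq; rewrite /x; lra.
Qed.

End IndependentSets.

(** * Weights and profiles *)

Section Weights.
Import boolp classical_sets.
Local Open Scope classical_set_scope.
Variables (R : realType) (k : nat) (P : 'M[R]_k).
Hypothesis P01 : forall i j, 0 <= P i j < 1.
Local Notation Q := (logmx P).
Implicit Types (x y : 'cV[R]_k) (S : seq 'cV[R]_k).

Lemma quadZ (a : R) (x : 'I_k -> R) : quad P (fun i => a * x i) = a ^+ 2 * quad P x.
Proof.
rewrite mulr_sumr; apply: eq_bigr => i _; rewrite mulr_sumr.
by apply: eq_bigr => j _; ring.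
Qed.

Lemma eq_quad (x x' : 'I_k -> R) : x =1 x' -> quad P x = quad P x'.
Proof. by move=> xx; apply: eq_bigr => i _; apply: eq_bigr => j _; rewrite !xx. Qed.

Lemma norm1_nonneg y : nonnegv y -> norm1 y = \sum_i y i 0.
Proof. by move=> y0; apply: eq_bigr => i _; rewrite ger0_norm. Qed.

Lemma qratioE y : qratio Q y = quad P (fun i => y i 0) / norm1 y.
Proof.
rewrite /qratio mxE /quad exchange_big /=; congr (_ / _); apply: eq_bigr => j _.
rewrite !mxE mulr_suml; apply: eq_bigr => i _; rewrite !mxE; ring.
Qed.

Lemma nonnegv_col (x : 'I_k -> R) : (forall i, 0 <= x i) -> nonnegv (\col_i x i).
Proof. by move=> x0 i; rewrite mxE. Qed.

Lemma norm1_col (x : 'I_k -> R) : (forall i, 0 <= x i) -> norm1 (\col_i x i) = \sum_i x i.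
Proof.
by move=> x0; rewrite norm1_nonneg; [apply: eq_bigr => i _; rewrite mxE | exact: nonnegv_col].
Qed.

Lemma qratio_col (x : 'I_k -> R) : (forall i, 0 <= x i) ->
  qratio Q (\col_i x i) = quad P x / \sum_i x i.
Proof.
move=> x0; rewrite qratioE norm1_col //; congr (_ / _).
by apply: eq_quad => i; rewrite mxE.
Qed.

Lemma prec0 y : prec 0 y <-> nonnegv y.
Proof. by rewrite /prec subr0. Qed.

Lemma precE y x : prec y x <-> forall i, y i 0 <= x i 0.
Proof.
by split=> yx i; have := yx i; rewrite !mxE subr_ge0.
Qed.

Lemma w_ge x y : nonnegv x -> nonnegv y -> (forall i, y i 0 <= x i 0) ->
  qratio Q y <= w x Q.
Proof.
move=> x0 y0 yx; apply: sup_upper_bound; first exact: w_has_sup.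
by exists y => //; split; [apply/prec0|apply/precE].
Qed.

Lemma w_le x (b : R) : nonnegv x ->
  (forall y, nonnegv y -> (forall i, y i 0 <= x i 0) -> qratio Q y <= b) -> w x Q <= b.
Proof.
move=> x0 yb; apply: ge_sup; first exact: (w_has_sup Q x0).1.
by move=> _ [y [/prec0 y0 /precE yx] <-]; exact: yb.
Qed.

Lemma qratio0 : qratio Q 0 = 0.
Proof.
rewrite qratioE /quad big1 ?mul0r // => i _; rewrite big1 // => j _.
by rewrite mxE !mul0r.
Qed.

Lemma w_ge0 x : nonnegv x -> 0 <= w x Q.
Proof.
move=> x0; rewrite -qratio0; apply: w_ge => // i; by rewrite mxE.
Qed.

Lemma qratioZ (a : R) y : 0 <= a -> qratio Q (a *: y) = a * qratio Q y.
Proof.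
rewrite le_eqVlt => /predU1P[<-|a0]; first by rewrite scale0r mul0r qratio0.
rewrite !qratioE.
have -> : quad P (fun i => (a *: y) i 0) = a ^+ 2 * quad P (fun i => y i 0).
  by rewrite -quadZ; apply: eq_quad => i; rewrite mxE.
have -> : norm1 (a *: y) = a * norm1 y.
  rewrite /norm1 mulr_sumr; apply: eq_bigr => i _.
  by rewrite mxE normrM gtr0_norm.
have [->|n0] := eqVneq (norm1 y) 0; first by rewrite mulr0 !invr0 !mulr0.
by field; rewrite n0 lt0r_neq0.
Qed.

Lemma wZ_le (a : R) y : 0 <= a -> nonnegv y -> w (a *: y) Q <= a * w y Q.
Proof.
move=> a0 y0; apply: w_le => [i|v v0 vy]; first by rewrite mxE mulr_ge0.
have [a00|a1] := eqVneq a 0.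
  have -> : v = 0.
    apply/matrixP => i j; rewrite (ord1 j); apply/eqP; rewrite eq_le !mxE v0 andbT.
    by have := vy i; rewrite a00 scale0r mxE.
  by rewrite qratio0 a00 mul0r.
have ap : 0 < a by rewrite lt0r a1.
have -> : v = a *: (a^-1 *: v) by rewrite scalerA divff // scale1r.
rewrite qratioZ // ler_wpM2l //; apply: w_ge => // i.
  by rewrite mxE mulr_ge0 ?invr_ge0.
by have := vy i; rewrite !mxE ler_pdivrMl.
Qed.

Definition system x S : Prop := {in S, forall y, nonnegv y} /\ \sum_(y <- S) y = x.

Lemma system_ge0 x S : system x S -> 0 <= \sum_(y <- S) w y Q.
Proof.
by move=> [S0 _]; rewrite big_seq; apply: sumr_ge0 => y /S0; exact: w_ge0.
Qed.

Lemma wstar_le x S : system x S -> wstar x Q <= \sum_(y <- S) w y Q.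
Proof.
move=> Sx; apply: ge_inf; last by exists S.
by exists 0 => _ [T Tx <-]; exact: system_ge0 Tx.
Qed.

Lemma system1 x : nonnegv x -> system x [:: x].
Proof. by move=> x0; split; [move=> y; rewrite inE => /eqP-> | rewrite big_seq1]. Qed.

Lemma wstar_ge x (b : R) : nonnegv x ->
  (forall S, system x S -> b <= \sum_(y <- S) w y Q) -> b <= wstar x Q.
Proof.
move=> x0 Sb; apply: lb_le_inf; last by move=> _ [S Sx <-]; exact: Sb.
by exists (\sum_(y <- [:: x]) w y Q); exists [:: x] => //; exact: system1.
Qed.

Lemma wstar_adherent x (e : R) : nonnegv x -> 0 < e ->
  exists2 S, system x S & \sum_(y <- S) w y Q <= wstar x Q + e.
Proof.
move=> x0 e0.
have [|_ [S Sx <-] lt] := @inf_adherent _ [set \sum_(y <- S) w y Q | S in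
    [set S : seq 'cV[R]_k | {in S, forall y, nonnegv y} /\ \sum_(y <- S) y = x]] e e0.
  split; first by exists (\sum_(y <- [:: x]) w y Q); exists [:: x] => //; exact: system1.
  by exists 0 => _ [T Tx <-]; exact: system_ge0 Tx.
by exists S => //; exact: ltW.
Qed.

(** The test vector is [y] restricted to block [i]. *)
Lemma w_ge_diag y i : nonnegv y -> y i 0 * Q i i <= w y Q.
Proof.
move=> y0; pose u j := if j == i then y i 0 else 0.
have u0 j : 0 <= u j by rewrite /u; case: ifP.
apply: le_trans (w_ge (y := \col_j u j) y0 _ _).
- rewrite qratio_col //.
  have -> : \sum_j u j = y i 0.
    by rewrite (bigD1 i) //= big1 ?addr0 /u ?eqxx // => j /negbTE->.
  have -> : quad P u = y i 0 * (y i 0 * Q i i).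
    rewrite /quad (bigD1 i) //= [X in _ + X]big1 ?addr0 => [|j /negbTE ji]; last first.
      by rewrite big1 // => l _; rewrite /u ji !mul0r.
    rewrite (bigD1 i) //= big1 ?addr0 => [|j /negbTE ji]; last by rewrite /u ji mulr0 mul0r.
    by rewrite /u eqxx mulrA.
  have [->|yi] := eqVneq (y i 0) 0; first by rewrite !mul0r.
  by rewrite mulrAC divff // mul1r.
- exact: nonnegv_col.
- by move=> j; rewrite mxE /u; case: eqP => [->|].
Qed.

(** Summing [w_ge_diag] over the [k] coordinates of each vector of a system. This yields the lower
    bound [qhat * N / k] for [wstar]. *)
Lemma wstar_ge_diag x : nonnegv x -> \sum_i x i 0 * Q i i <= k%:R * wstar x Q.
Proof.
move=> x0; have [k0|k0] := posnP k.
  move: x x0 P P01; rewrite k0 => x _ P' _; by rewrite big_ord0 mul0r.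
have kp : 0 < k%:R :> R by rewrite ltr0n.
rewrite -ler_pdivrMl //; apply: wstar_ge => // S [S0 <-].
rewrite ler_pdivrMl // mulr_sumr.
have -> : \sum_i (\sum_(y <- S) y) i 0 * Q i i = \sum_(y <- S) \sum_i y i 0 * Q i i.
  rewrite exchange_big /=; apply: eq_bigr => i _.
  by rewrite summxE mulr_suml.
rewrite big_seq [leRHS]big_seq; apply: ler_sum => y yS.
apply: le_trans (_ : \sum_(i < k) w y Q <= _).
  by apply: ler_sum => i _; apply: w_ge_diag; exact: S0.
by rewrite sumr_const card_ord mulr_natl.
Qed.

(** More than [k] vectors are linearly dependent. Moving the coefficients of the system along a
    dependence, in the direction that does not increase the total weight, until one vanishes loses a
    vector; homogeneity of [w] controls the rescaled ones. *)
Lemma system_shrink x S : system x S -> (k < size S)%N ->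
  exists2 S', system x S' &
    (size S' < size S)%N /\ \sum_(y <- S') w y Q <= \sum_(y <- S) w y Q.
Proof.
move=> [S0 Sx] kS.
set m := size S in kS *.
pose Y (j : 'I_m) := nth 0 S j.
have YS j : Y j \in S by rewrite mem_nth.
have Y0 j : nonnegv (Y j) by apply: S0.
have sumY (M : zmodType) (F : 'cV[R]_k -> M) : \sum_(y <- S) F y = \sum_j F (Y j).
  by rewrite (big_nth 0) big_mkord.
have [c c0 cY] : exists2 c : 'I_m -> R, (exists j, c j != 0) & \sum_j c j *: Y j = 0.
  pose A := \matrix_(j < m, i < k) Y j i 0.
  have : kermx A != 0.
    rewrite -mxrank_eq0 mxrank_ker subn_eq0 -ltnNge.
    exact: leq_ltn_trans (rank_leq_col _) kS.
  case/rowV0Pn => u /sub_kermxP uA u0.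
  exists (fun j => u 0 j).
    apply/existsP; apply: contraNT u0; rewrite negb_exists => /forallP u0.
    by apply/eqP/rowP => j; rewrite mxE; apply/eqP; have := u0 j; rewrite negbK.
  apply/matrixP => i j; rewrite (ord1 j) summxE mxE.
  move/matrixP/(_ 0 i): uA; rewrite !mxE => uA; rewrite -[RHS]uA.
  by apply: eq_bigr => l _; rewrite !mxE.
(* A zero vector is simply dropped. Otherwise a dependence must have a negative coefficient, since
   nonnegative nonzero vectors admit no nontrivial nonnegative combination equal to 0. *)
have [[j Yj]|Yn0] := pselect (exists j, Y j = 0).
  have jS : (0 : 'cV[R]_k) \in S by rewrite -Yj.
  have pS := perm_to_rem jS.
  have S0' : {subset rem 0 S <= S} by move=> y; exact: mem_rem.
  exists (rem 0 S); first split=> [y /S0' /S0 //|].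
    by rewrite -Sx (perm_big _ pS) /= big_cons add0r.
  split; first by rewrite size_rem // /m; case: (S) jS.
  by rewrite (perm_big _ pS) /= big_cons lerDr w_ge0 // -Yj.
have {c c0 cY} [c [c0 cY cw]] : exists c : 'I_m -> R,
    [/\ exists j, c j != 0, \sum_j c j *: Y j = 0 & \sum_j c j * w (Y j) Q <= 0].
  have [le0|/ltW ge0] := leP (\sum_j c j * w (Y j) Q) 0; first by exists c.
  exists (fun j => - c j); split.
  - by case: c0 => j cj; exists j; rewrite oppr_eq0.
  - by under eq_bigr do rewrite scaleNr; rewrite sumrN cY oppr0.
  - by under eq_bigr do rewrite mulNr; rewrite sumrN oppr_le0.
have [j1 cj1] : exists j, c j < 0.
  apply/existsP; apply: contraT; rewrite negb_exists => /forallP cge.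
  have cge0 j : 0 <= c j by rewrite leNgt cge.
  case: c0 => j cj; case: Yn0; exists j; apply/matrixP => i l; rewrite (ord1 l) mxE.
  have /matrixP/(_ i 0) := cY; rewrite summxE mxE => /eqP.
  rewrite psumr_eq0 => [|l' _]; last by rewrite mxE mulr_ge0 // Y0.
  move/allP/(_ j); rewrite mem_index_enum => /(_ isT) /=.
  by rewrite mxE mulf_eq0 (negbTE cj) => /eqP.
(* With the most negative coefficient at [js], all the factors [1 - c j / c js] are nonnegative and
   the one at [js] is 0. *)
have [js cjs] : exists js, forall j, c js <= c j.
  by exists [arg min_(j < j1) c j]%O; case: arg_minP => // i _ im j; exact: im.
have cn : c js < 0 by exact: le_lt_trans (cjs j1) cj1.
pose a j := 1 - c j / c js.
have a0 j : 0 <= a j by rewrite subr_ge0 ler_ndivrMr // mul1r.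
have ajs : a js = 0 by rewrite /a divff ?subrr // lt_eqF.
exists [seq a l *: Y l | l <- enum (predC1 js)]; first split.
- move=> _ /mapP[l _ ->] i; rewrite mxE mulr_ge0 //; exact: Y0.
- rewrite big_map big_enum /= -Sx sumY.
  transitivity (\sum_j a j *: Y j); first by rewrite [RHS](bigD1 js) //= ajs scale0r add0r.
  under eq_bigr do rewrite /a scalerBl scale1r mulrC -scalerA.
  by rewrite sumrB -scaler_sumr cY scaler0 subr0.
split; first by rewrite size_map -cardE cardC1 card_ord ltn_predL (leq_ltn_trans _ kS).
rewrite big_map big_enum /= sumY.
apply: le_trans (_ : \sum_j a j * w (Y j) Q <= _).
  rewrite [leRHS](bigD1 js) //= ajs mul0r add0r; apply: ler_sum => j _.
  by apply: wZ_le.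
have -> : \sum_j a j * w (Y j) Q =
    \sum_j w (Y j) Q - (c js)^-1 * \sum_j c j * w (Y j) Q.
  by rewrite mulr_sumr -sumrB; apply: eq_bigr => j _; rewrite /a; ring.
by rewrite lerBlDr lerDl mulr_le0 // invr_le0 ltW.
Qed.

Lemma caratheodory x S : system x S -> exists2 S', system x S' &
    (size S' <= k)%N /\ \sum_(y <- S') w y Q <= \sum_(y <- S) w y Q.
Proof.
move: {2}(size S) (leqnn (size S)) => m; elim: m S => [|m IHm] S Sm Sx.
  by exists S => //; split=> //; rewrite (leq_trans Sm).
have [Sk|kS] := leqP (size S) k; first by exists S.
have [S1 S1x [S1m S1w]] := system_shrink Sx kS.
have [|S2 S2x [S2k S2w]] := IHm S1 _ S1x; first by rewrite -ltnS (leq_trans S1m).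
by exists S2 => //; split=> //; exact: le_trans S2w S1w.
Qed.

End Weights.

(** * Convexity on boxes and weights of colour classes *)

Section Profiles.
Variables (R : realType) (k : nat) (P : 'M[R]_k).
Hypothesis P01 : forall i j, 0 <= P i j < 1.
Local Notation Q := (logmx P).

Definition upd (x : 'I_k -> R) (i : 'I_k) (t : R) (j : 'I_k) : R :=
  if j == i then t else x j.

Lemma quad_upd (x : 'I_k -> R) i : exists a b, forall t,
  quad P (upd x i t) = a + b * t + Q i i * t ^+ 2.
Proof.
exists (\sum_(l | l != i) \sum_(j | j != i) x l * x j * Q l j).
exists (\sum_(j | j != i) x j * Q i j + \sum_(l | l != i) x l * Q l i) => t.
rewrite /quad (bigD1 i) //= (bigD1 i) //= /upd eqxx.
have -> : \sum_(j | j != i) t * (if j == i then t else x j) * Q i j =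
    t * \sum_(j | j != i) x j * Q i j.
  by rewrite mulr_sumr; apply: eq_bigr => j /negbTE->; rewrite mulrA.
have -> : \sum_(l | l != i) \sum_j (if l == i then t else x l) *
      (if j == i then t else x j) * Q l j =
    \sum_(l | l != i) \sum_(j | j != i) x l * x j * Q l j +
    t * \sum_(l | l != i) x l * Q l i.
  rewrite mulr_sumr -big_split /=; apply: eq_bigr => l /negbTE->.
  rewrite (bigD1 i) //= eqxx addrC; congr (_ + _); last by ring.
  by apply: eq_bigr => j /negbTE->.
ring.
Qed.

(* Since [Q i i >= 0], the left side minus the right side is convex in each
   coordinate, so it is largest at a vertex of the box. *)
Lemma quad_box (lam : R) (y : 'I_k -> R) :
  (forall x, (forall i, x i = 0 \/ x i = y i) -> quad P x <= lam * \sum_i x i) ->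
  forall x, (forall i, 0 <= x i <= y i) -> quad P x <= lam * \sum_i x i.
Proof.
move=> vert x xy.
(* Induction on the list of coordinates still free to lie strictly between their end points. *)
have : forall i, i \notin enum 'I_k -> x i = 0 \/ x i = y i by move=> i; rewrite mem_enum.
elim: (enum 'I_k) x xy => [|i s IHs] x xy xs; first by apply: vert => i; exact: xs.
have /andP[xi0 xiy] := xy i.
have yi0 : 0 <= y i by exact: le_trans xi0 xiy.
have H t : t = 0 \/ t = y i -> quad P (upd x i t) <= lam * \sum_j upd x i t j.
  move=> tE; apply: IHs => [j|j js]; rewrite /upd; case: eqP => [->|/eqP ji].
  - by case: tE => ->; rewrite ?lexx ?yi0.
  - exact: xy.
  - exact: tE.
  - by apply: xs; rewrite in_cons negb_or ji.
have [a [b ab]] := quad_upd x i.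
pose c := \sum_(j | j != i) x j.
have sumE t : \sum_j upd x i t j = t + c.
  rewrite (bigD1 i) //= /upd eqxx; congr (_ + _).
  by apply: eq_bigr => j /negbTE->.
have updE j : x j = upd x i (x i) j by rewrite /upd; case: eqP => [->|].
rewrite (eq_quad P updE) (eq_bigr _ (fun j _ => updE j)) ab sumE.
have := H 0 (or_introl erefl); have := H (y i) (or_intror erefl).
rewrite !ab !sumE.
have qi := logmx_ge0 P01 i i.
pose tau := x i / y i.
have [tau0 tau1 ->] : [/\ 0 <= tau, tau <= 1 & x i = tau * y i].
  have [y0|yn] := eqVneq (y i) 0.
    rewrite /tau y0 invr0 mulr0; split=> //; rewrite mulr0; apply/eqP.
    by rewrite eq_le xi0 andbT -y0.
  have yp : 0 < y i by rewrite lt0r yn.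
  by split; rewrite /tau ?divr_ge0 ?ler_pdivrMr ?mul1r ?divfK.
move: (y i) yi0 => u u0 h1 h0.
have e1 : tau * (a + b * u + Q i i * u ^+ 2) <= tau * (lam * (u + c)) by rewrite ler_wpM2l.
have e0 : (1 - tau) * (a + b * 0 + Q i i * 0 ^+ 2) <= (1 - tau) * (lam * (0 + c)).
  by rewrite ler_wpM2l // subr_ge0.
have e2 : 0 <= Q i i * u ^+ 2 * (tau * (1 - tau)).
  apply: mulr_ge0; first by rewrite mulr_ge0 // exprn_ge0.
  by rewrite mulr_ge0 // subr_ge0.
rewrite -subr_ge0.
(* The gap is the convex combination of the gaps at the two end points plus the convexity term. *)
have -> : lam * (tau * u + c) - (a + b * (tau * u) + Q i i * (tau * u) ^+ 2) =
  (tau * (lam * (u + c)) - tau * (a + b * u + Q i i * u ^+ 2)) +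
  ((1 - tau) * (lam * (0 + c)) - (1 - tau) * (a + b * 0 + Q i i * 0 ^+ 2)) +
  Q i i * u ^+ 2 * (tau * (1 - tau)) by ring.
by apply: addr_ge0 => //; apply: addr_ge0; rewrite subr_ge0.
Qed.

Section Lower.
Variable n : 'I_k -> nat.
Implicit Types (A : {set vertex n}).

(** A vertex of the box below the profile of [A] keeps some blocks of [A] entirely and drops the
    others, so it is the profile of a subset of [A]. *)
Lemma w_prof (lam : R) A : 0 <= lam ->
  (forall A', A' \subset A -> quad P (profR R A') <= lam * #|A'|%:R) ->
  w (\col_i profR R A i) Q <= lam.
Proof.
move=> lam0 subA; have p0 i : 0 <= profR R A i by exact: ler0n.
apply: w_le => [|y y0 yA]; first exact: nonnegv_col.
rewrite qratioE norm1_nonneg //.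
have : quad P (fun i => y i 0) <= lam * \sum_i y i 0.
  apply: (quad_box (y := profR R A)) => [x xA|i]; last first.
    by have := yA i; rewrite mxE y0 => ->.
  pose A' := [set v in A | x (tag v) != 0].
  have xE i : x i = profR R A' i.
    have [x0|xn] := eqVneq (x i) 0.
      rewrite x0 /profR /prof (_ : [set _ in _ | _] = set0) ?cards0 //.
      apply/setP => v; rewrite !inE; apply/negP => /andP[/andP[_ +] /eqP vi].
      by rewrite vi x0 eqxx.
    case: (xA i) => [x0|->]; first by rewrite x0 eqxx in xn.
    rewrite /profR /prof; congr (_%:R); apply: eq_card => v; rewrite !inE.
    by case: (eqVneq (tag v) i) => [vi|_]; rewrite ?andbF // !andbT vi xn andbT.
  rewrite (eq_quad P xE) (eq_bigr _ (fun i _ => xE i)) -card_profR.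
  by apply: subA; apply/subsetP => v; rewrite inE => /andP[].
have [s0|sn] := eqVneq (\sum_i y i 0) 0; first by rewrite s0 invr0 !mulr0.
by rewrite ler_pdivrMr // lt0r sn sumr_ge0.
Qed.

(** The colour classes form a system, and subsets of a class are independent too, which is what
    [w_prof] asks. *)
Lemma colorable_wstar G (c : nat) (lam : R) : 0 <= lam ->
  (forall A, indep G A -> quad P (profR R A) <= lam * #|A|%:R) ->
  colorable G c -> wstar (vec_of R n) Q <= c%:R * lam.
Proof.
move=> lam0 iG /existsP[f /forallP fG].
pose cl a := [set v | f v == a].
have icl a A : A \subset cl a -> indep G A.
  move=> /subsetP Aa; apply: indepP => u v uA vA; apply/negP => Guv.
  have /forallP/(_ v) := fG u; rewrite Guv /=.
  by have := Aa u uA; have := Aa v vA; rewrite !inE => /eqP-> /eqP->; rewrite eqxx.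
pose S0 := [seq \col_i profR R (cl a) i | a <- enum 'I_c].
have sysS : system (vec_of R n) S0.
  split=> [_ /mapP[a _ ->]|]; first by apply: nonnegv_col => i; exact: ler0n.
  rewrite big_map big_enum /=; apply/matrixP => i j; rewrite summxE mxE.
  under eq_bigr do rewrite mxE.
  rewrite -natr_sum; congr (_%:R).
  rewrite -(prof_setT n i) /prof -[RHS]sum1_card.
  rewrite (partition_big (fun v => f v) xpredT) //=; apply: eq_bigr => a _.
  by rewrite sum1dep_card; apply: eq_card => v; rewrite !inE /= andbC.
apply: le_trans (wstar_le P sysS) _; rewrite /S0 big_map big_enum /=.
apply: le_trans (_ : \sum_(a < c) lam <= _); last by rewrite sumr_const card_ord mulr_natl.
apply: ler_sum => a _; apply: w_prof => // A' A'a; apply: iG; exact: icl A'a.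
Qed.

End Lower.

(** * Rounding a system to integer profiles *)

Section Cover.
Variables (n : 'I_k -> nat) (S : seq 'cV[R]_k) (eta L c : R).
Hypothesis Ssys : system (vec_of R n) S.
Hypotheses (eta0 : 0 < eta) (L0 : 0 < L) (c0 : 0 < c).
Hypothesis qsmall : forall i, Q i i + c <= 2 * L * eta.
Let lam := (1 + eta) * L.

(** The perturbation by [c] keeps the weight positive on nonzero vectors and bounds the size of the
    rounded profiles by [2 * lam / c]. *)
Let wt (y : 'cV[R]_k) : R := w y Q + c * norm1 y.
(** After scaling by [2 * L / wt y] such a coordinate is at least [1 / eta], so rounding it up costs
    a factor of at most [1 + eta]. *)
Let large (y : 'cV[R]_k) i := (0 < y i 0) && (wt y <= 2 * L * eta * y i 0).
Let zy (y : 'cV[R]_k) : {ffun 'I_k -> nat} :=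
  [ffun i => if large y i then (Num.truncn (2 * L * y i 0 / wt y)).+1 else 0%N].
Let Jy (y : 'cV[R]_k) : nat := (Num.truncn (wt y / (2 * L))).+1.
Let r i : R := \sum_(y <- S | ~~ large y i) y i 0.
(** The same rounding for a single block, where [Q i i + c] is the perturbed weight of a unit
    vector. *)
Let zi (i : 'I_k) : {ffun 'I_k -> nat} :=
  [ffun j => if j == i then (Num.truncn (2 * L / (Q i i + c))).+1 else 0%N].
Let Ji i : nat := (Num.truncn (r i * (Q i i + c) / (2 * L))).+1.

Let lam0 : 0 < lam. Proof. by rewrite /lam mulr_gt0 // addr_gt0. Qed.

Let lam2 : 0 <= 2 * lam. Proof. by rewrite mulr_ge0 // ltW. Qed.

Let truncS (x : R) : 0 <= x -> x <= (Num.truncn x).+1%:R <= x + 1.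
Proof.
move=> x0; have /andP[h1 h2] := truncn_itv x0.
by rewrite (ltW h2) -natr1 lerD2r.
Qed.

Let y0 y : y \in S -> forall i, 0 <= y i 0.
Proof. by move=> /Ssys.1. Qed.

Let norm0 (y : 'cV[R]_k) : 0 <= norm1 y.
Proof. by apply: sumr_ge0. Qed.

Let wt0 y : y \in S -> 0 <= wt y.
Proof. by move=> yS; rewrite addr_ge0 ?mulr_ge0 ?w_ge0 ?(ltW c0) //; exact: y0. Qed.

Let wt_large y i : y \in S -> large y i -> 0 < wt y.
Proof.
move=> yS /andP[yi _]; apply: ltr_wpDl; first by apply: w_ge0 => //; exact: y0.
rewrite mulr_gt0 // (lt_le_trans yi) //.
rewrite norm1_nonneg; last exact: y0.
by rewrite (bigD1 i) //= lerDl sumr_ge0 // => j _; exact: y0.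
Qed.

Let zy_le y i : y \in S -> (zy y i)%:R <= 2 * lam / wt y * y i 0.
Proof.
move=> yS; rewrite ffunE; case: ifP => [ly|_]; last first.
  apply: mulr_ge0; last exact: y0.
  by apply: divr_ge0; [exact: lam2|exact: wt0].
have wp := wt_large yS ly; have /andP[yi le] := ly.
have t0 : 0 <= 2 * L * y i 0 / wt y by rewrite divr_ge0 ?mulr_ge0 // ltW.
have /andP[_ h2] := truncS t0; apply: le_trans h2 _.
rewrite [leRHS]mulrAC ler_pdivlMr // mulrDl mul1r divfK ?lt0r_neq0 //.
by rewrite /lam; lra.
Qed.

Let zy_cover y i : y \in S -> large y i -> y i 0 <= (Jy y * zy y i)%:R.
Proof.
move=> yS ly; rewrite natrM ffunE ly.
have wp := wt_large yS ly; have /andP[yi le] := ly.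
have t0 : 0 <= 2 * L * y i 0 / wt y by rewrite divr_ge0 ?mulr_ge0 // ltW.
have s0 : 0 <= wt y / (2 * L) by rewrite divr_ge0 ?mulr_ge0 // ltW.
have /andP[h1 _] := truncS t0; have /andP[h2 _] := truncS s0.
apply: le_trans (ler_pM s0 t0 h2 h1).
have -> // : wt y / (2 * L) * (2 * L * y i 0 / wt y) = y i 0.
by field; rewrite !lt0r_neq0.
Qed.

(** A subprofile of [zy y] lies below [b *: y] with [b = 2 * lam / wt y]; by homogeneity its ratio
    is at most [b * w y Q], hence at most [2 * lam]. *)
Let good_zy y : y \in S -> good P lam (zy y).
Proof.
move=> yS l lz.
have [/eqP s0|sn] := boolP (\sum_i (l i)%:R == 0 :> R).
  rewrite s0 mulr0; have l0 i : (l i)%:R = 0 :> R.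
    move/eqP: s0; rewrite psumr_eq0 // => /allP/(_ i).
    by rewrite mem_index_enum => /(_ isT) /eqP.
  rewrite (eq_quad P l0) /quad big1 // => i _; rewrite big1 // => j _.
  by rewrite !mul0r.
have sp : 0 < \sum_i (l i)%:R :> R by rewrite lt0r sn sumr_ge0.
have wp : 0 < wt y.
  case: (pickP (fun i => large y i)) => [i ly|nl]; first exact: wt_large ly.
  move: sn; rewrite big1 ?eqxx // => i _.
  by have := lz i; rewrite ffunE nl leqn0 => /eqP->.
pose b := 2 * lam / wt y.
have b0 : 0 < b by rewrite divr_gt0 // mulr_gt0.
rewrite -ler_pdivrMr //.
rewrite -qratio_col //.
have -> : \col_i (l i)%:R = b *: (\col_i ((l i)%:R / b)) :> 'cV[R]_k.
  by apply/matrixP => i j; rewrite !mxE mulrC divfK // lt0r_neq0.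
rewrite qratioZ ?(ltW b0) //.
apply: le_trans (_ : b * w y Q <= _).
  rewrite ler_wpM2l ?(ltW b0) //; apply: w_ge => // i; first exact: y0.
    by rewrite mxE divr_ge0 // ltW.
  rewrite mxE ler_pdivrMr // mulrC; apply: le_trans (zy_le i yS).
  by rewrite ler_nat.
rewrite /b mulrAC ler_pdivrMr // ler_wpM2l ?lam2 //.
by rewrite /wt lerDl mulr_ge0 // ltW.
Qed.

Let sum_zy y : y \in S -> (\sum_i zy y i)%:R <= 2 * lam / c.
Proof.
move=> yS; rewrite natr_sum.
apply: le_trans (_ : \sum_i 2 * lam / wt y * y i 0 <= _).
  by apply: ler_sum => i _; exact: zy_le.
rewrite -mulr_sumr -norm1_nonneg; last exact: y0.
have [->|wn] := eqVneq (wt y) 0.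
  by rewrite invr0 mulr0 mul0r divr_ge0 ?lam2 // ltW.
have wp : 0 < wt y by rewrite lt0r wn wt0.
rewrite mulrAC ler_pdivrMr // -[leRHS]mulrA ler_wpM2l ?lam2 //.
rewrite ler_pdivlMl // mulrC /wt mulrC lerDr w_ge0 //; exact: y0.
Qed.

Let qc i : 0 < Q i i + c. Proof. by rewrite ltr_wpDl ?logmx_ge0. Qed.

Let zi_le i : (zi i i)%:R <= 2 * lam / (Q i i + c).
Proof.
rewrite ffunE eqxx.
have t0 : 0 <= 2 * L / (Q i i + c) by rewrite divr_ge0 ?mulr_ge0 // ltW.
have /andP[_ h2] := truncS t0; apply: le_trans h2 _.
rewrite ler_pdivlMr // mulrDl mul1r divfK ?lt0r_neq0 //.
by have := qsmall i; rewrite /lam; lra.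
Qed.

Let good_zi i : good P lam (zi i).
Proof.
move=> l lz.
have l0 j : j != i -> l j = 0%N.
  by move=> /negbTE ji; have := lz j; rewrite ffunE ji leqn0 => /eqP.
have -> : quad P (fun j => (l j)%:R) = (l i)%:R * ((l i)%:R * Q i i).
  rewrite /quad (bigD1 i) //= [X in _ + X]big1 ?addr0 => [|j ji]; last first.
    by rewrite big1 // => m _; rewrite l0 // !mul0r.
  rewrite (bigD1 i) //= big1 ?addr0 => [|j ji]; last by rewrite (l0 j) // mulr0 mul0r.
  by rewrite mulrA.
rewrite (bigD1 i) //= big1 ?addr0 => [|j ji]; last by rewrite l0.
rewrite [leRHS]mulrC ler_wpM2l //.
apply: le_trans (_ : 2 * lam / (Q i i + c) * Q i i <= _).
  rewrite ler_wpM2r ?logmx_ge0 //; apply: le_trans (zi_le i).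
  by rewrite ler_nat.
rewrite mulrAC ler_pdivrMr // ler_wpM2l ?lam2 //.
by rewrite lerDl ltW.
Qed.

Let sum_zi i : (\sum_j zi i j)%:R <= 2 * lam / c.
Proof.
rewrite (bigD1 i) //= big1 ?addn0 => [|j /negbTE ji]; last by rewrite ffunE ji.
apply: le_trans (zi_le i) _.
rewrite ler_wpM2l ?lam2 // lef_pV2 ?posrE //.
by rewrite lerDr logmx_ge0.
Qed.

Let r0 i : 0 <= r i.
Proof. by rewrite /r big_seq_cond; apply: sumr_ge0 => y /andP[yS _]; exact: y0. Qed.

Let zi_cover i : r i <= (Ji i * zi i i)%:R.
Proof.
rewrite natrM ffunE eqxx.
have t0 : 0 <= 2 * L / (Q i i + c) by rewrite divr_ge0 ?mulr_ge0 // ltW.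
have s0 : 0 <= r i * (Q i i + c) / (2 * L).
  by rewrite divr_ge0 ?mulr_ge0 ?r0 ?(ltW L0) ?(ltW (qc i)).
have /andP[h1 _] := truncS t0; have /andP[h2 _] := truncS s0.
apply: le_trans (ler_pM s0 t0 h2 h1).
have -> // : r i * (Q i i + c) / (2 * L) * (2 * L / (Q i i + c)) = r i.
by field; rewrite !lt0r_neq0.
Qed.

Let sumS i : \sum_(y <- S) y i 0 = (n i)%:R.
Proof.
by have := Ssys.2 => /(congr1 (fun v : 'cV[R]_k => v i 0)); rewrite summxE mxE.
Qed.

Let r_le i : r i <= (n i)%:R.
Proof.
rewrite -sumS [leRHS](bigID (fun y => large y i)) /= lerDr.
by rewrite big_seq_cond; apply: sumr_ge0 => y /andP[yS _]; exact: y0.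
Qed.

(** A positive coordinate that is not large is below [wt y / (2 * L * eta)]. *)
Let r_le_wt i : r i <= (\sum_(y <- S) wt y) / (2 * L * eta).
Proof.
have K0 : 0 < 2 * L * eta by rewrite !mulr_gt0.
rewrite ler_pdivlMr // mulr_suml big_mkcond /=.
rewrite big_seq [leRHS]big_seq; apply: ler_sum => y yS.
case: ifP => [|_]; last exact: wt0.
rewrite negb_and -leNgt -ltNge => /orP[yi|/ltW le]; last by rewrite mulrC.
apply: le_trans (wt0 yS); rewrite mulr_le0_ge0 // ltW //.
Qed.

Let items : seq ({ffun 'I_k -> nat} * nat) :=
  [seq (zy y, Jy y) | y <- S] ++ [seq (zi i, Ji i) | i <- enum 'I_k].

(* [zs] lists, with repetitions, the profiles of the colour classes to extract;
   [r i] is the part of block [i] that is covered by profiles supported on that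
   block only, because it lies in coordinates too small to survive rounding. *)
Lemma cover_profiles : exists (zl zs : seq {ffun 'I_k -> nat}) (r : 'I_k -> R),
  [/\ (size zl <= size S + k)%N /\ {subset zs <= zl},
      forall z, z \in zl -> good P lam z /\ (\sum_i z i)%:R <= 2 * lam / c,
      forall i, (n i <= \sum_(z <- zs) z i)%N,
      forall i, [/\ 0 <= r i, r i <= (n i)%:R &
        r i <= (\sum_(y <- S) w y Q + c * (\sum_i n i)%:R) / (2 * L * eta)] &
      (size zs)%:R <= (\sum_(y <- S) w y Q + c * (\sum_i n i)%:R
         + \sum_i r i * (Q i i + c)) / (2 * L) + (size S + k)%:R].
Proof.
have sum_wt : \sum_(y <- S) wt y = \sum_(y <- S) w y Q + c * (\sum_i n i)%:R.
  rewrite /wt big_split /= -mulr_sumr; congr (_ + c * _).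
  rewrite big_seq (eq_bigr (fun y : 'cV[R]_k => \sum_i y i 0)) => [|y yS].
    by rewrite -big_seq exchange_big /= natr_sum; apply: eq_bigr => i _; rewrite sumS.
  by rewrite norm1_nonneg //; exact: y0.
exists [seq a.1 | a <- items], (flatten [seq nseq a.2 a.1 | a <- items]), r; split.
- split; first by rewrite /items map_cat size_cat !size_map -enumT size_enum_ord.
  move=> z /flattenP[s /mapP[a aI ->]] /nseqP[-> _]; exact: map_f.
- move=> z /mapP[a]; rewrite mem_cat => /orP[]/mapP[x xS ->] -> /=.
    by split; [exact: good_zy|exact: sum_zy].
  by split; [exact: good_zi|exact: sum_zi].
- move=> i; rewrite big_flatten /= big_map.
  have -> : (\sum_(a <- items) \sum_(z <- nseq a.2 a.1) z i = \sum_(a <- items) a.2 * a.1 i)%N.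
    by apply: eq_bigr => a _; rewrite big_nseq iter_addn_0 mulnC.
  rewrite /items big_cat /= !big_map -enumT big_enum /= -(ler_nat R) natrD.
  (* Large coordinates are covered by the copies of [zy y]; the sum of the others is [r i], covered
     by the copies of [zi i]. *)
  rewrite -sumS (bigID (fun y => large y i)) /=; apply: lerD; last first.
    apply: le_trans (zi_cover i) _; rewrite ler_nat (bigD1 i) //= leq_addr //.
  rewrite natr_sum big_mkcond /= big_seq [leRHS]big_seq; apply: ler_sum => y yS.
  by case: ifP => // ly; exact: zy_cover.
- by move=> i; rewrite -sum_wt.
- rewrite size_flatten sumnE /shape !big_map -sum_wt.
  under eq_bigr do rewrite size_nseq.
  rewrite /items big_cat /= !big_map -enumT big_enum /= !natrD !natr_sum mulrDl [leRHS]addrACA.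
  have -> : (size S)%:R = \sum_(y <- S) 1 :> R by rewrite big_const_seq count_predT iter_addr_0.
  have -> : k%:R = \sum_(i < k) 1 :> R by rewrite sumr_const card_ord.
  rewrite !mulr_suml -!big_split /=; apply: lerD.
    rewrite big_seq [leRHS]big_seq; apply: ler_sum => y yS.
    have /truncS/andP[_ //] : 0 <= wt y / (2 * L).
    by rewrite divr_ge0 ?wt0 ?mulr_ge0 // ltW.
  apply: ler_sum => i _.
  have /truncS/andP[_ //] : 0 <= r i * (Q i i + c) / (2 * L).
  by rewrite divr_ge0 ?mulr_ge0 ?r0 ?(ltW L0) ?(ltW (qc i)).
Qed.

End Cover.
End Profiles.

(** * The chromatic number at a fixed size *)

Section Extremes.
Variables (R : realType) (k : nat).

Lemma qstar_ge (Q : 'M[R]_k) i : Q i i <= qstar Q.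
Proof. exact: (le_bigmax _ (fun i => Q i i)). Qed.

Lemma qmax_ge (Q : 'M[R]_k) i j : Q i j <= qmax Q.
Proof.
apply: le_trans (le_bigmax _ (fun i => \big[Num.max/0]_j Q i j) i).
exact: (le_bigmax _ (fun j => Q i j)).
Qed.

Lemma qmax_ge0 (Q : 'M[R]_k) : 0 <= qmax Q.
Proof. exact: bigmax_ge_id. Qed.

Lemma qstar_le_qmax (Q : 'M[R]_k) : qstar Q <= qmax Q.
Proof. by apply/bigmax_leP; split=> [|i _]; [exact: qmax_ge0 | exact: qmax_ge]. Qed.

Lemma norm1_vec_of (n : 'I_k -> nat) : norm1 (vec_of R n) = #|vertex n|%:R.
Proof.
rewrite norm1_nonneg => [|i]; last by rewrite mxE.
rewrite -cardsT card_prof natr_sum; apply: eq_bigr => i _.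
by rewrite mxE prof_setT.
Qed.

Lemma card_vertex (n : 'I_k -> nat) : #|vertex n| = (\sum_i n i)%N.
Proof. by rewrite -cardsT card_prof; apply: eq_bigr => i _; rewrite prof_setT. Qed.

End Extremes.

Section Core.
Variables (R : realType) (k : nat) (P : 'M[R]_k) (n : 'I_k -> nat).
Hypothesis symP : forall i j, P i j = P j i.
Hypothesis P01 : forall i j, 0 <= P i j < 1.
Hypothesis k0 : (0 < k)%N.
Local Notation Q := (logmx P).
Local Notation V := (vertex n).
Local Notation p := (@edge_prob R k n P).

(* [l] is the logarithm of the number of vertices, [tau] measures the distance
   of [sigma] to 1/4, [eta] is the relative error allowed, and [kap] bounds all
   the error terms o(1) of the hypotheses. *)
Variables (sigma tau eta mu kap l : R).
Let N : R := #|V|%:R.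
Let qs := qstar Q.
Let qm := qmax Q.
Let qh := qhat (vec_of R n) Q.
Let W := wstar (vec_of R n) Q.

Hypotheses (sig0 : 0 <= sigma) (sig1 : sigma <= 1 / 4 - tau).
Hypotheses (mu0 : 0 < mu) (mueta : mu <= eta) (mutau : mu <= tau) (eta1 : eta <= 1 / 16).
Hypothesis kapE : kap = mu ^+ 3 / 64.
Hypothesis NE : N = expR l.
Hypothesis kapl : 1 <= kap * l.
Hypothesis big : (16 + 2 / eta + 2 * expR 1) * (l + 1) <= expR (kap * l).
Hypothesis kle : k%:R <= expR (kap * l).
Hypothesis qs_le : qs <= expR ((kap - sigma) * l).
Hypothesis qs_gt0 : 0 < qs.
Hypothesis qh_ge : expR (- (sigma + kap) * l) <= qh.
Hypothesis qm_le : (1 + 1 / qs) * qm <= kap * l.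
Hypothesis W_ge : k%:R * qh * qs * (N / l) <= kap * W.

Let eta0 : 0 < eta. Proof. exact: lt_le_trans mueta. Qed.
Let kap0 : 0 < kap. Proof. by rewrite kapE divr_gt0 ?exprn_gt0. Qed.
(** The cube in [kap] serves two ends: [kap] is small against [eta * mu] for the large overlaps in
    Janson's inequality, and against [eta ^+ 3] for the cost of the one-block profiles. *)
Let kap_eta2 : kap <= eta * mu / 64.
Proof.
rewrite kapE ler_pM2r ?invr_gt0 // 2!exprS expr1.
have m1 : mu * mu <= eta * mu by rewrite ler_wpM2r // ltW.
have m2 : mu * (mu * mu) <= 1 * (mu * mu).
  by rewrite ler_wpM2r ?mulr_ge0 ?(ltW mu0) //; move: mueta eta1; lra.
by move: m1 m2; lra.
Qed.
Let kap_eta3 : kap <= eta ^+ 3 / 64.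
Proof. by rewrite kapE ler_pM2r ?invr_gt0 // lerXn2r // nnegrE ltW. Qed.
Let kap_mu : kap <= mu / 1000.
Proof.
apply: le_trans kap_eta2 _.
have : eta * mu <= 1 / 16 * mu by rewrite ler_wpM2r // ltW.
move: mu0; lra.
Qed.
Let l0 : 0 < l.
Proof. by rewrite -(pmulr_rgt0 _ kap0); move: kapl; lra. Qed.
Let lkap : l >= 1000.
Proof.
have : kap * l <= l / 1000.
  by rewrite mulrC ler_wpM2l ?(ltW l0) //; move: kap_mu mueta eta1; lra.
by move: kapl; lra.
Qed.
Let N0 : 0 < N. Proof. by rewrite NE expR_gt0. Qed.
Let lnN : ln N = l. Proof. by rewrite NE expRK. Qed.
Let Nl : l <= N. Proof. by rewrite NE; have := expR_ge1Dx l; lra. Qed.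
Let qm0 : 0 <= qm. Proof. exact: qmax_ge0. Qed.
Let qsqm : qs <= qm. Proof. exact: qstar_le_qmax. Qed.
Let qmk : qm <= kap * l.
Proof.
apply: le_trans qm_le; rewrite ler_peMl // lerDl divr_ge0 // ltW //.
Qed.
Let qmqs : qm <= kap * l * qs.
Proof.
rewrite -ler_pdivrMr //; apply: le_trans qm_le.
by rewrite mulrDl mul1r div1r mulrC lerDr.
Qed.
Let kp : 1 <= k%:R :> R. Proof. by rewrite ler1n. Qed.
Let kp0 : 0 < k%:R :> R. Proof. by rewrite ltr0n. Qed.
Let qh0 : 0 < qh. Proof. by apply: lt_le_trans qh_ge; exact: expR_gt0. Qed.
Let nn0 : nonnegv (vec_of R n). Proof. by move=> i; rewrite mxE. Qed.
Let qhN : qh * N = \sum_i (n i)%:R * Q i i.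
Proof.
rewrite /qh /qhat norm1_vec_of divfK ?lt0r_neq0 //.
by apply: eq_bigr => i _; rewrite mxE.
Qed.
Let qhqs : qh <= qs.
Proof.
rewrite -(ler_pM2r N0) qhN /N card_vertex natr_sum mulr_sumr; apply: ler_sum => i _.
by rewrite mulrC ler_wpM2r // qstar_ge.
Qed.
Let qhW : qh * N <= k%:R * W.
Proof.
rewrite qhN; apply: le_trans (wstar_ge_diag P01 nn0).
by apply: ler_sum => i _; rewrite [vec_of R n i 0]mxE.
Qed.
Let W0 : 0 < W.
Proof. by rewrite -(pmulr_rgt0 _ kp0); apply: lt_le_trans qhW; rewrite mulr_gt0. Qed.
Let lnqs : ln qs <= (kap - sigma) * l.
Proof. by rewrite -ler_expR lnK. Qed.

Let bad0 (G : {set {set V}}) := [exists A : {set V},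
  (2 * ((1 - sigma + eta) * l) * #|A|%:R < quad P (profR R A)) && indep G A].

Let kml : kap * l <= mu * l / 1000.
Proof. by rewrite mulrAC ler_wpM2r // ltW. Qed.
Let mel : mu * l <= eta * l. Proof. by rewrite ler_wpM2r // ltW. Qed.
Let mtl : mu * l <= tau * l. Proof. by rewrite ler_wpM2r // ltW. Qed.
Let el : eta * l <= l / 16.
Proof. by rewrite mulrC ler_wpM2l ?(ltW l0) //; move: eta1; lra. Qed.
Let sl0 : 0 <= sigma * l. Proof. by rewrite mulr_ge0 // ltW. Qed.
Let sl : sigma * l <= l / 4 - tau * l.
Proof.
have : sigma * l <= (1 / 4 - tau) * l by rewrite ler_wpM2r // ltW.
by lra.
Qed.

(** With [u0 = 1 + 1 / qs] the hypothesis on [qm] gives [qm * u0 <= kap * l], and [ln (N / u0)] is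
    at most [(1 - sigma + kap) * l], so the margin [eta * l] makes the exponent negative. *)
Let bad0_prob : pprob p bad0 <= expR (- (kap * l)).
Proof.
pose lam := (1 - sigma + eta) * l; pose u0 := 1 + 1 / qs.
have u00 : 1 <= u0 by rewrite /u0 lerDl divr_ge0 // ltW.
have up : 0 < u0 by apply: lt_le_trans u00.
have lu : ln (N / u0) <= l + (kap - sigma) * l.
  rewrite ln_div ?posrE // lnN lerD2l.
  have : ln (1 / qs) <= ln u0 by rewrite ler_ln ?posrE ?divr_gt0 // /u0 lerDr.
  by rewrite div1r lnV ?posrE //; have := lnqs; lra.
have lam0 : l / 2 <= lam by rewrite /lam; move: sl mtl el mel kml kapl l0; lra.
have tl : qm / 2 - lam + ln (N / u0) <= - (2 * (kap * l)).
  by rewrite /lam; move: qmk lu kml mel kapl; lra.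
have lam1 : 0 <= lam by move: lam0 l0; lra.
apply: le_trans (sparse_indep symP P01 (@qmax_ge _ _ _) qm0 up N0 (lexx _) lam1 _ _) _.
- by rewrite mulrC (le_trans qm_le) //; move: lam0 kml mel el; lra.
- by rewrite -/qm; move: tl kapl; lra.
rewrite ler_expR -/qm.
have t1 : 1 + (qm / 2 - lam) + ln (N / u0) <= - (kap * l) by move: tl kapl; lra.
apply: le_trans t1; rewrite ler_neMl //; move: tl kapl; lra.
Qed.

Let lam := (1 - sigma - eta) * l.
Let L := lam / (1 + eta).
(** Small enough that [c * N <= eta * W], yet large enough that the profile size [2 * lam / c] is at
    most [N] to the power [sigma + 3 * kap]. *)
Let c := eta * qh / k%:R.

Let lamE : (1 + eta) * L = lam.
Proof. by rewrite /L mulrC divfK // lt0r_neq0 // addr_gt0. Qed.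
Let Ll : l / 4 <= L.
Proof.
rewrite /L ler_pdivlMr ?addr_gt0 // /lam.
by move: sl mtl mel kml kapl el l0; lra.
Qed.
Let L0 : 0 < L. Proof. by move: Ll l0; lra. Qed.
Let c0 : 0 < c. Proof. by apply: divr_gt0 => //; apply: mulr_gt0. Qed.
Let cN : c * N <= eta * W.
Proof.
rewrite /c mulrAC ler_pdivrMr //.
by have := qhW; rewrite -(ler_pM2l eta0); lra.
Qed.
Let cqs : c <= qs.
Proof.
apply: le_trans qhqs; rewrite /c ler_pdivrMr // mulrC ler_wpM2l ?(ltW qh0) //.
by move: eta1 kp; lra.
Qed.
Let qsmall i : Q i i + c <= 2 * L * eta.
Proof.
apply: le_trans (_ : kap * l + kap * l <= _).
  apply: lerD; first by apply: le_trans (qmax_ge _ _ _) qmk.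
  by apply: le_trans cqs _; apply: le_trans qsqm qmk.
have : l / 4 * eta <= L * eta by rewrite ler_wpM2r // ltW.
by move: kml mel kapl; lra.
Qed.

Let cover : exists zl zs : seq {ffun 'I_k -> nat},
  [/\ (size zl <= 2 * k)%N, {subset zs <= zl},
      forall z, z \in zl -> good P lam z /\ (\sum_i z i)%:R <= 2 * lam / c,
      forall i, (n i <= \sum_(z <- zs) z i)%N &
      (size zs)%:R <= (1 + 4 * eta) * W / (2 * L) + 2 * k%:R].
Proof.
have [S0 S0x S0w] := wstar_adherent P nn0 (mulr_gt0 eta0 W0).
have [S Sx [Sk Sw]] := caratheodory P S0x.
have {}Sw : \sum_(y <- S) w y Q <= (1 + eta) * W.
  by apply: le_trans Sw _; apply: le_trans S0w _; rewrite mulrDl mul1r.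
have [zl [zs [r [[szl sub] gz cov rP szs]]]] := cover_profiles P01 Sx eta0 L0 c0 qsmall.
rewrite lamE in gz; rewrite -card_vertex -/N in szs.
exists zl, zs; split=> //.
  by rewrite (leq_trans szl) // mul2n -addnn leq_add2r.
apply: le_trans szs _; apply: lerD; last first.
  by rewrite natrD mulr2n mulrDl mul1r lerD2r ler_nat.
have L2 : 0 < 2 * L by exact: mulr_gt0.
rewrite ler_pM2r ?invr_gt0 //.
have rc : \sum_i r i * c <= eta * W.
  apply: le_trans cN; rewrite /N card_vertex natr_sum mulr_sumr.
  by apply: ler_sum => i _; rewrite mulrC ler_wpM2l ?(ltW c0) //; case: (rP i).
have r1 : \sum_i r i * Q i i <= qh * N.
  rewrite qhN; apply: ler_sum => i _; rewrite ler_wpM2r ?logmx_ge0 //; by case: (rP i).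
have r2 : \sum_i r i * Q i i <= k%:R * qs * (4 * W / (eta * l)).
  have B i : r i <= 4 * W / (eta * l).
    case: (rP i) => _ _; rewrite -card_vertex -/N => /le_trans; apply.
    have P1 : 0 < 2 * L * eta by apply: mulr_gt0 => //; apply: mulr_gt0.
    have P2 : 0 < eta * l by exact: mulr_gt0.
    rewrite ler_pdivrMr // [leRHS]mulrAC ler_pdivlMr //.
    apply: le_trans (_ : (2 * W) * (eta * l) <= _).
      rewrite ler_wpM2r ?mulr_ge0 ?(ltW l0) ?(ltW eta0) //.
      have : eta * W <= W / 16.
        by rewrite mulrC ler_wpM2l ?(ltW W0) //; move: eta1; lra.
      by move: cN Sw W0; lra.
    have : l / 4 * (W * eta) <= L * (W * eta) by rewrite ler_wpM2r ?mulr_ge0 // ltW.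
    by lra.
  apply: le_trans (_ : \sum_(i < k) qs * (4 * W / (eta * l)) <= _).
    apply: ler_sum => i _; rewrite mulrC ler_pM ?logmx_ge0 //; first by case: (rP i).
    exact: qstar_ge.
  by rewrite sumr_const card_ord -[leLHS]mulr_natl mulrA.
(* The cost of the one-block profiles. If [k * qs / l] is small, the bound on [r i] through the
   total weight suffices; otherwise [W_ge] forces [qh * N], which bounds the sum trivially, below
   [eta * W]. *)
have rq : \sum_i r i * Q i i <= eta * W.
  pose a := k%:R * qs / l.
  have a0 : 0 < a by rewrite divr_gt0 ?mulr_gt0.
  have aE : a * (qh * N) <= kap * W.
    by apply: le_trans W_ge; rewrite /a le_eqVlt; apply/orP; left; apply/eqP; ring.
  have [aS|aB] := leP a (eta ^+ 2 / 4).
    apply: le_trans r2 _.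
    have -> : k%:R * qs * (4 * W / (eta * l)) = a * (4 * W / eta).
      by rewrite /a; field; rewrite !lt0r_neq0.
    apply: le_trans (_ : eta ^+ 2 / 4 * (4 * W / eta) <= _).
      by rewrite ler_wpM2r // divr_ge0 ?mulr_ge0 // ltW.
    rewrite le_eqVlt; apply/orP; left; apply/eqP.
    by field; rewrite lt0r_neq0.
  apply: le_trans r1 _.
  have qN0 : 0 <= qh * N by rewrite mulr_ge0 // ltW.
  have h1 : eta ^+ 2 / 4 * (qh * N) <= kap * W.
    by apply: le_trans aE; rewrite ler_wpM2r // ltW.
  have h2 : kap * W <= eta ^+ 3 / 64 * W by rewrite ler_wpM2r // ltW.
  have h3 : eta ^+ 2 * (qh * N) <= eta ^+ 2 * (eta * W).
    have : 0 <= eta ^+ 3 * W by rewrite mulr_ge0 ?exprn_ge0 // ltW.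
    have -> : eta ^+ 2 * (eta * W) = eta ^+ 3 * W by ring.
    by move: h1 h2; lra.
  by rewrite ler_pM2l ?exprn_gt0 in h3.
have -> : \sum_i r i * (Q i i + c) = \sum_i r i * Q i i + \sum_i r i * c.
  by rewrite -big_split; apply: eq_bigr => i _; rewrite mulrDr.
by move: cN Sw rc rq; lra.
Qed.

Let el_mu : 0 < mu * l. Proof. exact: mulr_gt0. Qed.

Let lam_le : lam <= l.
Proof. by rewrite /lam; move: sl0 mel el_mu; lra. Qed.
Let lam_gt0 : 0 < lam.
Proof. by rewrite /lam; move: sl mtl el l0 el_mu; lra. Qed.

Let lam2_gt0 : 0 < 2 * lam. Proof. exact: mulr_gt0. Qed.

Let big16 : 16 <= expR (kap * l).
Proof.
apply: le_trans big; have e0 := expR_gt0 (1 : R).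
have e1 : 0 <= 2 / eta by rewrite divr_ge0 // ltW.
have -> : (16 + 2 / eta + 2 * expR 1) * (l + 1) =
  16 + 16 * l + 2 / eta * (l + 1) + 2 * (expR 1 * (l + 1)) by ring.
have h1 : 0 <= 2 / eta * (l + 1) by rewrite mulr_ge0 // addr_ge0 // ltW.
have h2 : 0 <= expR 1 * (l + 1) by rewrite mulr_ge0 ?addr_ge0 ?(ltW l0) // ltW.
by move: h1 h2 l0; lra.
Qed.

Let big_eta : 2 * l / eta <= expR (kap * l).
Proof.
apply: le_trans big; have e0 := expR_gt0 (1 : R).
have e1 : 0 <= 2 / eta by rewrite divr_ge0 // ltW.
have h1 : 0 <= expR 1 * (l + 1) by rewrite mulr_ge0 ?addr_ge0 ?(ltW l0) // ltW.
have -> : (16 + 2 / eta + 2 * expR 1) * (l + 1) =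
  16 * (l + 1) + 2 * l / eta + 2 / eta + 2 * (expR 1 * (l + 1)) by ring.
by move: h1 e1 l0; lra.
Qed.

Let big_e : 2 * expR 1 * l + 4 * l + 2 <= expR (kap * l).
Proof.
apply: le_trans big; have e0 := expR_gt0 (1 : R).
have e1 : 0 <= 2 / eta * (l + 1) by rewrite mulr_ge0 ?divr_ge0 ?addr_ge0 // ltW.
have -> : (16 + 2 / eta + 2 * expR 1) * (l + 1) =
  16 * (l + 1) + 2 / eta * (l + 1) + 2 * expR 1 * l + 2 * expR 1 by ring.
by move: e0 e1 l0; lra.
Qed.

Let bige1 : expR 1 + 1 <= expR (kap * l).
Proof.
apply: le_trans big_e; have e0 := expR_gt0 (1 : R).
have : expR 1 * 1 <= expR 1 * l by rewrite ler_wpM2l ?(ltW e0) //; move: lkap; lra.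
by move: l0; lra.
Qed.

Let expkt : expR (kap * l) <= expR (tau * l).
Proof. by rewrite ler_expR; move: kml mtl kapl; lra. Qed.

Let Mr := 2 * lam / c.

Let Mr0 : 0 < Mr. Proof. by apply: divr_gt0 => //; apply: mulr_gt0. Qed.

Let Mr_le : Mr <= expR ((sigma + 3 * kap) * l).
Proof.
have -> : Mr = 2 * lam / eta * k%:R / qh.
  by rewrite /Mr /c; field; rewrite ?lt0r_neq0.
have -> : (sigma + 3 * kap) * l = kap * l + kap * l - (- (sigma + kap) * l) by ring.
rewrite expRB expRD; apply: ler_pM.
- by apply: mulr_ge0 => //; apply: divr_ge0; [exact: ltW lam2_gt0 | exact: ltW].
- by rewrite invr_ge0 ltW.
- apply: ler_pM => //.
    by apply: divr_ge0; [exact: ltW lam2_gt0 | exact: ltW].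
  apply: le_trans big_eta; rewrite ler_pM2r ?invr_gt0 //.
  by move: lam_le; lra.
- by rewrite lef_pV2 ?posrE ?expR_gt0.
Qed.

Let M := Num.truncn Mr.
Let M_le : M%:R <= Mr. Proof. by rewrite truncn_le ltW. Qed.

(** Slot size. The loss [mu / 4] in the exponent makes the leftover [k * M * g] smaller than [N] by
    a power, and is still small against the margin [eta] in [lam]. *)
Let gr := expR ((1 - sigma - mu / 4) * l).
Let g := (Num.truncn gr).+1.
Let gr1 : 1 <= gr.
Proof.
rewrite -[leLHS]expR0 ler_expR.
by move: sl mtl mel el l0 el_mu; lra.
Qed.
Let g_ge : gr <= g%:R.
Proof. by have /truncn_itv/andP[_ /ltW] : 0 <= gr by exact: expR_ge0. Qed.
Let g_le : g%:R <= 2 * gr.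
Proof.
have /truncn_itv/andP[h _] : 0 <= gr by exact: expR_ge0.
by rewrite /g -natr1; move: gr1 h; lra.
Qed.
Let g0 : 0 < g%:R :> R. Proof. by rewrite ltr0n. Qed.

(** Chosen so that Janson's bound [expR (- (1 / (4 * D)))] beats the number of vertex sets. *)
Let D := expR (- (1 + tau) * l).

Let tau_le : tau * l <= l / 4.
Proof. by move: sl sl0; lra. Qed.

(* Overlaps of size at most [L1] are bounded through [qmax], larger ones through
   the goodness of [z]. *)
Let D_bound (z : 'I_k -> nat) : good P lam z -> (\sum_i z i)%:R <= Mr ->
  \sum_(X : {set vertex z} | (1 < #|X|)%N) expR (eloss P X) * g%:R^-1 ^+ #|X| <= D.
Proof.
move=> gz zM.
(* The threshold [L1] is the largest multiple of [1 + 1 / qs] for which the hypothesis on [qm]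
   yields [qm * L1 <= 2 * a]. *)
pose a := mu / 4 * l; pose f := mu / 2 / kap; pose L1 := f * (1 + 1 / qs).
have fE : f * kap = mu / 2 by rewrite /f divfK ?lt0r_neq0.
have f0 : 0 < f by rewrite /f !divr_gt0.
have f1 : 1 <= f by rewrite /f ler_pdivlMr // mul1r; move: kap_mu mu0; lra.
have iq0 : 0 < 1 / qs by rewrite divr_gt0.
have q1 : 1 <= 1 + 1 / qs by move: iq0; lra.
have L1f : f <= L1 by rewrite /L1 ler_peMr // ltW.
have L1q : 1 / qs <= L1.
  apply: le_trans (_ : 1 + 1 / qs <= _); first by rewrite lerDr.
  by rewrite /L1 ler_peMl //; move: q1; lra.
have L10 : 0 < L1 by apply: lt_le_trans L1f.
have lnL1 : (sigma - kap) * l <= ln L1.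
  have : ln (1 / qs) <= ln L1 by rewrite ler_ln ?posrE.
  by rewrite div1r lnV ?posrE //; move: lnqs; lra.
have lnMr : ln Mr <= (sigma + 3 * kap) * l by rewrite -ler_expR lnK ?posrE.
have lng : (1 - sigma - mu / 4) * l <= ln g%:R by rewrite -ler_expR lnK ?posrE.
have qL1 : qm * L1 <= 2 * a.
  have : f * ((1 + 1 / qs) * qm) <= f * (kap * l) by rewrite ler_wpM2l // ltW.
  rewrite [f * (kap * l)]mulrA fE.
  have -> : qm * L1 = f * ((1 + 1 / qs) * qm) by rewrite /L1; ring.
  by rewrite /a; lra.
(* The exponent is [2 * sigma - 1 + 3 * kap + mu / 2]; as [sigma <= 1 / 4 - tau], it is at most
   [- (1 / 2 + tau)]. The square is then below [1 / N] by a power. *)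
have rho : Mr * expR a / g%:R <= expR (- (1 / 2 + tau) * l).
  rewrite ler_pdivrMr //.
  apply: le_trans (_ : expR (- (1 / 2 + tau) * l) * gr <= _); last first.
    by rewrite ler_wpM2l ?expR_ge0.
  apply: le_trans (_ : expR ((sigma + 3 * kap) * l) * expR a <= _).
    by rewrite ler_wpM2r ?expR_ge0.
  rewrite -!expRD ler_expR /a.
  by move: sl kml mtl el_mu; lra.
have tail : lam - ln g%:R + ln (Mr / L1) <= - (eta * l / 2).
  rewrite ln_div ?posrE // /lam.
  by move: lng lnMr lnL1 kml mel el_mu; lra.
have el0 : 0 < eta * l by exact: mulr_gt0.
apply: le_trans (transversal_sum_le (M := Mr) (a := a) (L0 := L1) P01 _ gz
  (@qmax_ge _ _ _) qm0 Mr0 zM L10 qL1 _ _) _ => //.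
- apply: le_trans rho _; rewrite -[leRHS]expR0 ler_expR.
  by move: mtl el_mu l0; lra.
- by move: tail el0; lra.
(* Since [L1 >= f] and [f * eta >= 8], the exponent is at most [- 2 * l]. *)
have part2 : expR (L1 * (1 + (lam - ln g%:R) + ln (Mr / L1))) <= expR (- (1 + 2 * tau) * l).
  rewrite ler_expR.
  have t2 : 1 + (lam - ln g%:R) + ln (Mr / L1) <= - (eta * l / 4).
    by move: tail kapl kml mel; lra.
  apply: le_trans (_ : L1 * - (eta * l / 4) <= _); first by rewrite ler_pM2l.
  apply: le_trans (_ : f * - (eta * l / 4) <= _).
    by rewrite ler_wnM2r // oppr_le0 divr_ge0 // ltW.
  have : 8 <= f * eta.
    have -> : f * eta = eta * mu / 2 / kap by rewrite /f; ring.
    by rewrite ler_pdivlMr //; move: kap_eta2 kap0; lra.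
  move=> /(ler_wpM2r (ltW l0)); move: tau_le l0; lra.
have part1 : (Mr * expR a / g%:R) ^+ 2 * expR 1 <= expR (- (1 + 2 * tau) * l) * expR 1.
  rewrite ler_wpM2r ?expR_ge0 //.
  have -> : - (1 + 2 * tau) * l = 2%:R * (- (1 / 2 + tau) * l) by field.
  rewrite expRM_natl lerXn2r ?nnegrE ?expR_ge0 //.
  by apply: divr_ge0 => //; apply: mulr_ge0; rewrite ?expR_ge0 ?(ltW Mr0).
apply: le_trans (lerD part1 part2) _.
rewrite -[X in _ + X]mulr1 -mulrDr /D.
have -> : - (1 + tau) * l = - (1 + 2 * tau) * l + tau * l by ring.
rewrite expRD ler_wpM2l ?expR_ge0 //.
exact: le_trans bige1 expkt.
Qed.

Let bad1 (zl : seq {ffun 'I_k -> nat}) (G : {set {set V}}) :=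
  has (fun z : {ffun 'I_k -> nat} =>
      [exists W, ~~ extractable G (cut (M * g) W z) W]) zl.

Let bad1_prob (zl : seq {ffun 'I_k -> nat}) : (size zl <= 2 * k)%N ->
  (forall z, z \in zl -> good P lam z /\ (\sum_i z i)%:R <= Mr) ->
  pprob p (bad1 zl) <= expR (- (kap * l)).
Proof.
move=> szl gz.
have D0 : 0 < D by exact: expR_gt0.
apply: le_trans (union_extract symP P01 (g := g) (M := M) _ D0 _ _) _ => //.
- move=> z zz W'; have [gz1 gz2] := gz z zz; apply: D_bound.
    move=> x xz; apply: gz1 => i; apply: leq_trans (xz i) _.
    by rewrite /cut; case: ifP.
  apply: le_trans gz2; rewrite ler_nat; apply: leq_sum => i _.
  by rewrite /cut; case: ifP.
- move=> z zz i; have [_ gz2] := gz z zz.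
  apply: leq_trans (_ : (\sum_i z i <= _)%N); first by rewrite (bigD1 i) //= leq_addr.
  by rewrite truncn_ge_nat // ltW.
(* Janson's bound is thus at most [expR (- 4 * N)], while the profiles and the vertex sets together
   number at most [expR (3 * N)]. *)
have DE : 4 * N <= 1 / (4 * D).
  have -> : 1 / (4 * D) = N * (expR (tau * l) / 4).
    rewrite /D NE.
    have -> : - (1 + tau) * l = - (l + tau * l) by ring.
    rewrite expRN expRD; field; rewrite ?lt0r_neq0 ?expR_gt0 //.
  rewrite mulrC ler_pM2l //.
  by have := le_trans big16 expkt; lra.
have h1 : (size zl)%:R <= expR (2 * N).
  apply: le_trans (_ : 2 * N <= _); last by have := expR_ge1Dx (2 * N); lra.
  apply: le_trans (_ : (2 * k)%:R <= _); first by rewrite ler_nat.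
  rewrite natrM ler_pM2l // (le_trans kle) // NE ler_expR.
  by move: kml mel el l0; lra.
have h2 : 2 ^+ #|V| <= expR N :> R.
  rewrite -[N]mulr1 /N expRM_natl lerXn2r ?nnegrE ?expR_ge0 //.
  by have := expR_ge1Dx (1 : R); lra.
have h3 : expR (- (1 / (4 * D))) <= expR (- (4 * N)) by rewrite ler_expR lerN2.
apply: le_trans (_ : expR (2 * N) * (expR N * expR (- (4 * N))) <= _).
  by rewrite ler_pM ?ler0n ?mulr_ge0 ?expR_ge0 ?exprn_ge0 // ler_pM ?expR_ge0 ?exprn_ge0.
rewrite -!expRD ler_expR.
by move: Nl kml mel el l0; lra.
Qed.

Let r := (k * (M * g))%N.
(** The first term cancels the exponential moment of the edge count; [4 * l] leaves [- 2 * l] per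
    vertex, half of which pays for choosing the vertices. *)
Let dr := expR 1 * (qm * r%:R) + 4 * l.
Let d := (Num.truncn dr).+1.
Let dr0 : 0 <= dr.
Proof.
apply: addr_ge0; last by rewrite mulr_ge0 // ltW.
by apply: mulr_ge0; [exact: expR_ge0 | apply: mulr_ge0].
Qed.
Let d_ge : dr <= d%:R.
Proof. by have /andP[_ /ltW] := truncn_itv dr0. Qed.
Let d_le : d%:R <= dr + 1.
Proof. by have /andP[h _] := truncn_itv dr0; rewrite /d -natr1 lerD2r. Qed.

Let bad2 (G : {set {set V}}) := [exists X : {set V}, [&& X != set0, (#|X| <= r)%N &
     [forall v in X, (d < degin G X v)%N]]].

Let bad2_prob : pprob p bad2 <= expR (- (kap * l)).
Proof.
have x2 : (expR 1 * (qm * r%:R) - d%:R) / 2 <= - (2 * l).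
  by have := d_ge; rewrite /dr; lra.
apply: le_trans (sparse_degen symP P01 (@qmax_ge _ _ _) qm0 N0 (lexx _) _) _.
  by rewrite lnN -/qm; move: x2 l0; lra.
rewrite lnN -/qm ler_expR.
by move: x2 kml mel el l0 kapl; lra.
Qed.

(** [W] is at least [qh * N / k], hence at least [N] to the power [1 - sigma - 2 * kap], whereas
    [qm * r] has exponent about [1 - sigma - mu / 4]; the gain [mu / 4] exceeds all multiples of
    [kap] involved. *)
Let few_extra : 2 * k%:R + d.+1%:R <= eta * W / l.
Proof.
pose x := expR (kap * l); pose B := expR ((1 - sigma - 3 * kap) * l).
have x16 : 16 <= x := big16.
have B0 : 0 < B by exact: expR_gt0.
have BW : B <= eta * W / l.
  have h1 : expR (- (kap * l)) <= eta / l.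
    rewrite expRN -[eta / l]invf_div lef_pV2 ?posrE ?expR_gt0 ?divr_gt0 //.
    by apply: le_trans big_eta; rewrite ler_pM2r ?invr_gt0 //; move: l0; lra.
  have h2 : expR ((1 - sigma - 2 * kap) * l) <= W.
    rewrite -(ler_pM2l kp0); apply: le_trans qhW.
    apply: le_trans (_ : expR (kap * l) * expR ((1 - sigma - 2 * kap) * l) <= _).
      by rewrite ler_wpM2r ?expR_ge0.
    apply: le_trans (_ : expR (- (sigma + kap) * l) * N <= _); last first.
      by rewrite ler_wpM2r // ltW.
    rewrite NE -!expRD ler_expR le_eqVlt; apply/orP; left; apply/eqP; ring.
  have -> : B = expR (- (kap * l)) * expR ((1 - sigma - 2 * kap) * l).
    by rewrite /B -expRD; congr expR; ring.
  by rewrite mulrAC ler_pM ?expR_ge0.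
have Bx : expR ((1 - sigma - 4 * kap) * l) <= B / 16.
  have -> : (1 - sigma - 4 * kap) * l = (1 - sigma - 3 * kap) * l - kap * l by ring.
  by rewrite expRB ler_pM2l // lef_pV2 ?posrE ?expR_gt0.
have rB : r%:R <= 2 * expR ((1 + 4 * kap - mu / 4) * l).
  rewrite /r !natrM.
  apply: le_trans (_ : expR (kap * l) * (expR ((sigma + 3 * kap) * l) * (2 * gr)) <= _).
    rewrite ler_pM ?mulr_ge0 ?ler0n // ler_pM ?ler0n //.
    exact: le_trans M_le Mr_le.
  rewrite [X in _ * X]mulrCA [leLHS]mulrCA ler_pM2l // -!expRD ler_expR.
  by rewrite le_eqVlt; apply/orP; left; apply/eqP; ring.
have part1 : expR 1 * (qm * r%:R) <= B / 16.
  apply: le_trans Bx.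
  apply: le_trans (_ : expR 1 * (l * expR ((kap - sigma) * l) *
      (2 * expR ((1 + 4 * kap - mu / 4) * l))) <= _).
    rewrite ler_pM2l ?expR_gt0 // ler_pM ?ler0n //.
    apply: le_trans qmqs _; rewrite ler_pM ?mulr_ge0 ?(ltW kap0) ?(ltW l0) ?(ltW qs_gt0) //.
    by rewrite ler_piMl ?(ltW l0) //; move: kap_mu mueta eta1; lra.
  have -> : expR 1 * (l * expR ((kap - sigma) * l) * (2 * expR ((1 + 4 * kap - mu / 4) * l)))
    = 2 * expR 1 * l * expR ((1 - sigma + 5 * kap - mu / 4) * l).
    have -> : (1 - sigma + 5 * kap - mu / 4) * l =
      (kap - sigma) * l + (1 + 4 * kap - mu / 4) * l by ring.
    by rewrite expRD; ring.
  apply: le_trans (_ : expR (kap * l) * expR ((1 - sigma + 5 * kap - mu / 4) * l) <= _).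
    rewrite ler_wpM2r ?expR_ge0 //; apply: le_trans big_e.
    by move: l0; lra.
  rewrite -expRD ler_expR.
  by move: kml el_mu; lra.
have part2 : 4 * l + 2 + 2 * k%:R <= B / 16.
  apply: le_trans Bx.
  apply: le_trans (_ : 3 * x <= _).
    have e0 := expR_gt0 (1 : R).
    have : 0 <= expR 1 * l by rewrite mulr_ge0 // ltW.
    by move: big_e kle; rewrite -/x; lra.
  apply: le_trans (_ : x * x <= _).
    by rewrite ler_wpM2r //; [exact: expR_ge0 | move: x16; lra].
  rewrite -expRD ler_expR.
  by move: kml mel el sl el_mu mtl; lra.
apply: le_trans BW.
by rewrite -natr1; move: d_le part1 part2 B0; rewrite /dr; lra.
Qed.

Lemma chromatic_core (eps Y : R) : 13 * eta <= eps ->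
  Y = W / (2 * (1 - sigma) * l) ->
  1 - 3 * expR (- (kap * l)) <= sbm_prob P (fun G : {set {set V}} =>
    (1 - eps) * Y <= (chromatic_number G)%:R <= (1 + eps) * Y).
Proof.
move=> eps0 Ydef.
have s34 : 3 / 4 <= 1 - sigma by move: sig1 mutau mu0; lra.
have s1 : 1 - sigma <= 1 by move: sig0; lra.
have YE : W = 2 * (1 - sigma) * l * Y.
  by rewrite Ydef mulrC divfK // mulf_neq0 ?lt0r_neq0 // mulr_gt0 //; move: s34; lra.
have Y0 : 0 < Y.
  by rewrite Ydef divr_gt0 // !mulr_gt0 //; move: s34; lra.
have [zl [zs [szl sub gz cov szs]]] := cover.
pose bad G := bad0 G || bad1 zl G || bad2 G.
have badP : pprob p bad <= 3 * expR (- (kap * l)).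
  apply: le_trans (pprobU (edge_prob01W P01 (n := n)) (fun G => bad0 G || bad1 zl G) bad2) _.
  apply: le_trans (lerD (pprobU (edge_prob01W P01 (n := n)) bad0 (bad1 zl)) (lexx _)) _.
  by move: bad0_prob (bad1_prob szl gz) bad2_prob; lra.
apply: le_trans (_ : 1 - pprob p bad <= _); first by rewrite lerD2l lerN2.
apply: sbm_prob_ge => // G sG; rewrite !negb_or => /andP[/andP[nb0 nb1] nb2].
have [Gchi chi_min] := chromatic_numberP sG.
apply/andP; split.
  (* Lower bound: [W] is at most [lam2] times the chromatic number, and [(1 - 13 * eta) * (1 - sigma
     + eta) <= 1 - sigma] because [1 - sigma >= 3 / 4]. *)
  pose lam2 := 2 * ((1 - sigma + eta) * l).
  have lam20 : 0 < lam2.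
    by rewrite /lam2 !mulr_gt0 //; move: s34 eta0; lra.
  have ind A : indep G A -> quad P (profR R A) <= lam2 * #|A|%:R.
    move=> iA; rewrite leNgt; apply: contra nb0 => bA.
    by apply/existsP; exists A; rewrite bA.
  have := colorable_wstar P01 (ltW lam20) ind Gchi; rewrite -/W => Wchi.
  rewrite -(ler_pM2r lam20); apply: le_trans Wchi; rewrite YE.
  have -> : (1 - eps) * Y * lam2 = 2 * l * Y * ((1 - eps) * (1 - sigma + eta)).
    by rewrite /lam2; ring.
  have -> : 2 * (1 - sigma) * l * Y = 2 * l * Y * (1 - sigma) by ring.
  rewrite ler_pM2l; last by rewrite !mulr_gt0.
  have : 13 * eta * (1 - sigma + eta) <= eps * (1 - sigma + eta).
    by rewrite ler_wpM2r //; move: s34 eta0; lra.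
  have : eta * (3 / 4) <= eta * (1 - sigma) by rewrite ler_wpM2l // ltW.
  have : 0 < eta * eta by rewrite mulr_gt0.
  by move: eta0; lra.
have col : pcol G setT (size zs + d.+1).
  apply: (greedy_coloring (theta := (M * g)%N)).
  - move=> z /sub zz W'; apply: contraT => nex.
    case/negP: nb1; apply/hasP; exists z => //; apply/existsP; exists W'; exact: nex.
  (* The leftover has at most [M * g] vertices in each block, so at most [r] in all, and the
     complement of [bad2] makes it [d]-degenerate. *)
  - move=> W' W'p; apply: pcol_degen => X XW X0.
    move: nb2; rewrite negb_exists => /forallP/(_ X).
    rewrite X0 /= negb_and negb_forall_in => /orP[|/exists_inP[v vX]]; last first.
      by rewrite -leqNgt; exists v.
    case/negP; apply: leq_trans (subset_leq_card XW) _.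
    rewrite card_prof /r -[X in (_ <= X * _)%N]card_ord -sum_nat_const.
    by apply: leq_sum => i _.
  - by move=> i; rewrite prof_setT (leq_trans (cov i)) // leq_addr.
have chi_le : (chromatic_number G)%:R <= (size zs)%:R + d.+1%:R :> R.
  by rewrite -natrD ler_nat; apply: chi_min; exact: pcol_colorable.
apply: le_trans chi_le _.
have WL : W / (2 * L) <= (1 + eta) * ((1 + 2 * eta) * Y).
  have se : 0 < 1 - sigma - eta by move: s34 eta1; lra.
  have -> : W / (2 * L) = (1 + eta) * (W / (2 * (1 - sigma - eta) * l)).
    rewrite /L /lam; field; rewrite ?lt0r_neq0 //; by move: eta0; lra.
  rewrite ler_pM2l; last by move: eta0; lra.
  rewrite ler_pdivrMr; last by rewrite !mulr_gt0.
  rewrite YE.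
  have -> : 2 * (1 - sigma) * l * Y = 2 * l * Y * (1 - sigma) by ring.
  have -> : (1 + 2 * eta) * Y * (2 * (1 - sigma - eta) * l) =
     2 * l * Y * ((1 + 2 * eta) * (1 - sigma - eta)) by ring.
  rewrite ler_pM2l; last by rewrite !mulr_gt0.
  have : eta * (3 / 4) <= eta * (1 - sigma) by rewrite ler_wpM2l // ltW.
  have : eta * eta <= eta * (1 / 16) by rewrite ler_wpM2l // ltW.
  by move: eta0; lra.
have Wl : eta * W / l <= 2 * eta * Y.
  rewrite ler_pdivrMr // YE.
  have -> : eta * (2 * (1 - sigma) * l * Y) = 2 * eta * Y * l * (1 - sigma) by ring.
  by rewrite ler_piMr // !mulr_ge0 // ltW.
(* The factors [1 + 4 * eta], [1 + eta] and [1 + 2 * eta] multiply to at most [1 + 11 * eta];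
   [few_extra] adds the last [2 * eta], whence the constant 13. *)
have main : (1 + 4 * eta) * W / (2 * L) <= (1 + 11 * eta) * Y.
  rewrite -mulrA; apply: le_trans (_ : (1 + 4 * eta) * ((1 + eta) * ((1 + 2 * eta) * Y)) <= _).
    by rewrite ler_pM2l //; move: eta0; lra.
  rewrite !mulrA ler_pM2r //.
  have e2 : eta * eta <= eta * (1 / 16) by rewrite ler_wpM2l // ltW.
  have e3 : eta * eta * eta <= eta * (1 / 16) * 1.
    by rewrite ler_pM ?mulr_ge0 ?(ltW eta0) //; move: eta1; lra.
  by move: e2 e3 eta0; lra.
have : (1 + 13 * eta) * Y <= (1 + eps) * Y by rewrite ler_wpM2r ?(ltW Y0) // lerD2l.
by move: szs main Wl few_extra; lra.
Qed.

End Core.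

(** * The limit *)

From mathcomp Require Import all_classical all_reals all_analysis.
Import Order.TTheory GRing.Theory Num.Theory.
Import numFieldNormedType.Exports.
Local Open Scope classical_set_scope.

(** The exponential is the square of [expR (kap * l / 2)], hence at least
    [kap ^+ 2 * l ^+ 2 / 4]. *)
Lemma expR_dominates_affine (R : realType) (K kap l : R) : 0 <= K -> 0 < kap -> 1 <= l ->
  8 * K <= kap ^+ 2 * l -> K * (l + 1) <= expR (kap * l).
Proof.
move=> K0 kap0 l1 Kl.
have -> : kap * l = 2%:R * (kap * l / 2) by field.
rewrite expRM_natl; apply: le_trans (_ : (kap * l / 2) ^+ 2 <= _).
  have : 8 * K * l <= kap ^+ 2 * l * l by rewrite ler_wpM2r //; lra.
  have : K * 1 <= K * l by rewrite ler_wpM2l.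
  by rewrite !expr2; lra.
have h0 : 0 <= kap * l / 2 by rewrite divr_ge0 // mulr_ge0 // ?ltW //; lra.
apply: lerXn2r; rewrite ?nnegrE ?expR_ge0 //.
by have := expR_ge1Dx (kap * l / 2); lra.
Qed.

Lemma is_powo_near (R : realType) (N s f : nat -> R) (kap : R) : 0 < kap ->
  is_powo N s f -> (\forall n \near \oo, 1 <= N n) ->
  \forall n \near \oo, expR ((s n - kap) * ln (N n)) <= f n <= expR ((s n + kap) * ln (N n)).
Proof.
move=> kap0 [e /cvgrPdist_le/(_ _ kap0) e0 fE] N1; near=> n.
have N1n : 1 <= N n by near: n.
have -> : f n = N n `^ (s n + e n) by near: n.
rewrite /powR gt_eqF ?(lt_le_trans _ N1n) // !ler_expR.
have en : `|0 - e n| <= kap by near: n.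
have l0 : 0 <= ln (N n) by exact: ln_ge0.
move: en; rewrite sub0r normrN ler_norml => /andP[h1 h2].
by rewrite !ler_wpM2r //; lra.
Unshelve. all: by end_near. Qed.

Theorem theorem2p1 (R : realType) (sigma0 : R) (sigma : nat -> R)
    (k : nat -> nat) (nv : forall n, 'I_(k n) -> nat)
    (P : forall n, 'M[R]_(k n)) :
  let nn := fun n => vec_of R (nv n) in
  let N := fun n => norm1 (nn n) in
  let Q := fun n => logmx (P n) in
  0 < sigma0 < 1 / 4 ->
  (forall n, 0 <= sigma n <= sigma0) ->
  (forall n, (0 < k n)%N) ->
  (forall n i j, P n i j = P n j i) ->
  (forall n i j, 0 <= P n i j < 1) ->
  N n @[n --> \oo] --> +oo ->
  is_powo N (fun=> 0) (fun n => (k n)%:R) ->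
  is_powo N (fun n => - sigma n) (fun n => qstar (Q n)) ->
  is_powo N (fun n => - sigma n) (fun n => qhat (nn n) (Q n)) ->
  lls (fun n => (1 + 1 / qstar (Q n)) * qmax (Q n)) (fun n => ln (N n)) ->
  lls (fun n => (k n)%:R * qhat (nn n) (Q n) * qstar (Q n) * (N n / ln (N n)))
      (fun n => wstar (nn n) (Q n)) ->
  forall eps : R, 0 < eps ->
    let Y := fun n => wstar (nn n) (Q n) / (2 * (1 - sigma n) * ln (N n)) in
    sbm_prob (P n) (fun G : {set {set vertex (nv n)}} =>
        (1 - eps) * Y n <= (chromatic_number G)%:R <= (1 + eps) * Y n)
      @[n --> \oo] --> (1 : R).
Proof.
move=> nn N Q /andP[_ sigma04] sigmaP k0 symP P01 Noo kpow qspow qhpow /llsP qmlls /llsP Wlls.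
move=> eps eps0 Y.
pose tau := 1 / 4 - sigma0.
have tau0 : 0 < tau by rewrite /tau; lra.
pose eta := Num.min (eps / 13) (1 / 16).
have eta0 : 0 < eta by rewrite lt_min; apply/andP; split; lra.
have eta16 : eta <= 1 / 16 by rewrite ge_min lexx orbT.
have eta_eps : 13 * eta <= eps.
  by have : eta <= eps / 13 by [rewrite ge_min lexx]; lra.
pose mu := Num.min eta tau.
have mu0 : 0 < mu by rewrite lt_min eta0.
have mueta : mu <= eta by rewrite ge_min lexx.
have mutau : mu <= tau by rewrite ge_min lexx orbT.
pose kap := mu ^+ 3 / 64.
have kap0 : 0 < kap by rewrite divr_gt0 ?exprn_gt0.
pose K := 16 + 2 / eta + 2 * expR 1.
have K0 : 0 <= K.
  by rewrite /K !addr_ge0 ?mulr_ge0 ?expR_ge0 ?invr_ge0 // ltW.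
apply/cvgrPdist_lt => d d0.
(* Once [ln (N n) >= A], the three summands give [1 <= l], then [1 + 3 / d <= kap * l], which puts
   the failure probability [3 * expR (- (kap * l))] below [d], and finally the hypothesis of
   [expR_dominates_affine]. *)
pose A := 1 + (1 + 3 / d) / kap + 8 * K / kap ^+ 2.
have Nlarge (B : R) : \forall n \near \oo, B <= N n by move: B; apply/cvgryPge; exact: Noo.
have N1 := Nlarge 1.
have := is_powo_near kap0 kpow N1; have := is_powo_near kap0 qspow N1.
have := is_powo_near kap0 qhpow N1; have := qmlls _ kap0; have := Wlls _ kap0.
move=> FW Fqm Fqh Fqs Fk; near=> n.
have NA : expR A <= N n by near: n; exact: Nlarge.
have Np : 0 < N n by apply: lt_le_trans NA; exact: expR_gt0.
have lA : A <= ln (N n) by rewrite -ler_expR lnK.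
have /andP[_ kn] : 
    expR ((0 - kap) * ln (N n)) <= (k n)%:R <=
    expR ((0 + kap) * ln (N n)) by near: n.
have /andP[qs1 qs2] : 
    expR ((- sigma n - kap) * ln (N n)) <= qstar (Q n) <=
    expR ((- sigma n + kap) * ln (N n)) by near: n.
have /andP[qh1 _] : 
    expR ((- sigma n - kap) * ln (N n)) <= qhat (nn n) (Q n) <=
    expR ((- sigma n + kap) * ln (N n)) by near: n.
have qmn : `|(1 + 1 / qstar (Q n)) * qmax (Q n)| <= kap * `|ln (N n)| by near: n.
have Wn :
    `|(k n)%:R * qhat (nn n) (Q n) * qstar (Q n) * (N n / ln (N n))| <=
    kap * `|wstar (nn n) (Q n)| by near: n.
have NE : #|vertex (nv n)|%:R = expR (ln (N n)) by rewrite lnK // -norm1_vec_of.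
have NV : N n = #|vertex (nv n)|%:R by rewrite -norm1_vec_of.
set l := ln (N n) in lA kn qs1 qs2 qh1 qmn Wn NE.
have [h1 h2] : 0 <= (1 + 3 / d) / kap /\ 0 <= 8 * K / kap ^+ 2.
  have d3 : 0 <= 3 / d by rewrite divr_ge0 // ltW.
  split; apply: divr_ge0; [exact: addr_ge0 | exact: ltW | exact: mulr_ge0 |].
  by rewrite exprn_ge0 // ltW.
have l1 : 1 <= l by move: lA; rewrite /A; lra.
have kl : 1 + 3 / d <= kap * l.
  by rewrite -ler_pdivrMl // mulrC; move: lA; rewrite /A; lra.
have k2l : 8 * K <= kap ^+ 2 * l.
  by rewrite -ler_pdivrMl ?exprn_gt0 // mulrC; move: lA; rewrite /A; lra.
have d3 : 0 < 3 / d by rewrite divr_gt0.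
have kl1 : 1 <= kap * l by lra.
have W0 : 0 <= wstar (nn n) (Q n).
  apply: wstar_ge => [i|S [S0 _]]; first by rewrite mxE.
  by rewrite big_seq; apply: sumr_ge0 => y /S0; exact: w_ge0.
have /andP[sg0 sg1] := sigmaP n.
have qs0 : 0 < qstar (Q n) by apply: lt_le_trans qs1; exact: expR_gt0.
have core := @chromatic_core R (k n) (P n) (nv n) (symP n) (P01 n) (k0 n) (sigma n) tau eta mu
  kap l sg0 _ mu0 mueta mutau eta16 (erefl _) NE kl1 _ _ _ qs0 _ _ _ eps (Y n) eta_eps (erefl _).
have {core} : 1 - 3 * expR (- (kap * l)) <= sbm_prob (P n) (fun G : {set {set vertex (nv n)}} =>
        (1 - eps) * Y n <= (chromatic_number G)%:R <= (1 + eps) * Y n).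
  apply: core.
  - by rewrite /tau; lra.
  - exact: expR_dominates_affine.
  - by move: kn; rewrite add0r.
  - by rewrite (addrC kap).
  - by rewrite opprD.
  - apply: le_trans (ler_norm _) _; apply: le_trans qmn _.
    by rewrite (@ger0_norm _ l) //; lra.
  - rewrite -NV; apply: le_trans (ler_norm _) _; apply: le_trans Wn _.
    by rewrite ger0_norm.
set pr := sbm_prob _ _ => core.
have pr1 : pr <= 1 by apply: sbm_prob_le1; exact: P01.
rewrite ger0_norm ?subr_ge0 //.
apply: le_lt_trans (_ : 3 * expR (- (kap * l)) < _); first by lra.
rewrite expRN ltr_pdivrMr ?expR_gt0 // mulrC -ltr_pdivrMr //.
by have := expR_ge1Dx (kap * l); lra.
Unshelve. all: by end_near. Qed.
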